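(* Let $\Gamma$ be a countable group. If $\Gamma$ is shift-minimal then $\Gamma$ has no non-trivial normal amenable subgroups.
   Context: A measure preserving (m.p.) action $\boldsymbol a=\Gamma\curvearrowright^a(X,\mu)$ is a Borel action of the countable discrete group $\Gamma$ on a standard probability space (possibly with atoms) preserving $\mu$. It is trivial if $\mu$ is a point mass, non-trivial otherwise. It is free if $\mu(\{x:\gamma^a x=x\})=0$ for every $\gamma\in\Gamma\setminus\{e\}$. For m.p. actions $\boldsymbol a=\Gamma\curvearrowright^a(X,\mu)$ and $\boldsymbol b=\Gamma\curvearrowright^b(Y,\nu)$, $\boldsymbol a$ is weakly contained in $\boldsymbol b$ if for all Borel $A_1,\dots,A_n\subseteq X$, finite $F\subseteq\Gamma$ and $\epsilon>0$ there are Borel $B_1,\dots,B_n\subseteq Y$ with $|\mu(\gamma^aA_i\cap A_j)-\nu(\gamma^bB_i\cap B_j)|<\epsilon$ for all $\gamma\in F$, $i,j\le n$. The Bernoulli shift $\boldsymbol s_\Gamma$ is the m.p. action of $\Gamma$ on $([0,1]^\Gamma,\lambda^\Gamma)$ ($\lambda$ Lebesgue measure) given by $(\gamma f)(\delta)=f(\gamma^{-1}\delta)$. $\Gamma$ is shift-minimal if every non-trivial m.p. action of $\Gamma$ weakly contained in $\boldsymbol s_\Gamma$ is free. The trivial subgroup is $\{e\}$. *)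

(* Defs.v *)
From HB Require Import structures.
From mathcomp Require Import all_boot all_order all_algebra.
From mathcomp Require Import all_classical all_reals all_analysis.

Set Implicit Arguments.
Unset Strict Implicit.
Unset Printing Implicit Defensive.

Import Order.TTheory GRing.Theory Num.Theory.
Local Open Scope classical_set_scope.
Local Open Scope ring_scope.

Definition subgroup (G : groupType) (N : set G) : Prop := group_closed (mem N).

Definition normal_subgroup (G : groupType) (N : set G) : Prop :=
  subgroup N /\ forall g x : G, N x -> N (x ^ g)%g.

(* Amenability of a subgroup N as a discrete group: a left-invariant finitely additive
   probability measure on the subsets of N (values of m elsewhere are
   irrelevant). *)
Definition amenable (R : realType) (G : groupType) (N : set G) : Prop :=
  exists m : set G -> R,
    [/\ m N = 1,
        forall A, A `<=` N -> 0 <= m A,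
        forall A B, A `<=` N -> B `<=` N -> A `&` B = set0 ->
          m (A `|` B) = m A + m B
      & forall g A, N g -> A `<=` N -> m [set (g * x)%g | x in A] = m A].

Definition complete_metric (R : realType) (T : metricType R) : Prop :=
  forall F : set_system T, ProperFilter F -> cauchy F -> exists l : T, F --> l.

Definition separable (T : topologicalType) : Prop :=
  exists2 D : set T, countable D & dense D.

(* X is isomorphic, as a measurable space, to a Polish space with its Borel
   sigma-algebra. *)
Definition standard_borel (R : realType) d (X : measurableType d) : Prop :=
  exists (T : metricType R) (f : X -> T),
    [/\ complete_metric T, separable T, bijective f
      & forall B : set T, <<s open >> B <-> measurable (f @^-1` B)].

Section actions.
Context (R : realType) (G : groupType).

Definition mp_action d (X : measurableType d) (mu : probability X R)
    (a : G -> X -> X) : Prop :=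
  [/\ standard_borel R X,
      forall x, a 1%g x = x,
      forall g h x, a (g * h)%g x = a g (a h x),
      forall g, measurable_fun [set: X] (a g)
    & forall g A, measurable A -> mu (a g @` A) = mu A].

Definition point_mass d (X : measurableType d) (mu : probability X R) : Prop :=
  exists x : X, forall A, measurable A -> mu A = \d_x A.

Definition free_action d (X : measurableType d) (mu : probability X R)
    (a : G -> X -> X) : Prop :=
  forall g : G, g <> 1%g -> mu [set x | a g x = x] = 0%E.

Definition weakly_contained d (X : measurableType d) (mu : probability X R)
    (a : G -> X -> X) d' (Y : measurableType d') (nu : probability Y R)
    (b : G -> Y -> Y) : Prop :=
  forall (n : nat) (A : 'I_n -> set X) (F : set G) (e : R),
    (forall i, measurable (A i)) -> finite_set F -> 0 < e ->
    exists B : 'I_n -> set Y, (forall i, measurable (B i)) /\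
      forall g i j, F g ->
        (`| mu (a g @` A i `&` A j) - nu (b g @` B i `&` B j) | < e%:E)%E.

End actions.

Definition unit_itv (R : realType) : Type := {x : R | 0 <= x <= 1}.

HB.instance Definition _ (R : realType) := Choice.on (unit_itv R).

Fact unit_itv_subproof (R : realType) : (0 : R) <= (0 : R) <= 1.
Proof. by rewrite lexx ler01. Qed.

HB.instance Definition _ (R : realType) :=
  isPointed.Build (unit_itv R) (exist _ 0 (unit_itv_subproof R)).

Section bernoulli.
Context (R : realType) (G : groupType).

Definition unit_borel (B : set (unit_itv R)) : Prop :=
  exists2 C : set R, measurable C & B = sval @^-1` C.

Definition unit_lebesgue (B : set (unit_itv R)) : \bar R :=
  lebesgue_measure (sval @` B).

Definition coordinate_sets : set (set (G -> unit_itv R)) :=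
  [set A | exists (g : G) (B : set (unit_itv R)),
             unit_borel B /\ A = [set f | B (f g)]].

Definition shift_space := g_sigma_algebraType coordinate_sets.

(* On the product sigma-algebra, the product rule on finite-dimensional
   cylinders determines the probability measure (existence and uniqueness are
   Kolmogorov's theorem); so this says lam = lambda^G. *)
Definition product_lebesgue (lam : probability shift_space R) : Prop :=
  forall (s : seq G) (B : G -> set (unit_itv R)),
    uniq s -> (forall g, unit_borel (B g)) ->
    lam [set f | forall g, g \in s -> B g (f g)]
      = (\prod_(g <- s) unit_lebesgue (B g))%E.

Definition shift (g : G) (f : shift_space) : shift_space :=
  fun h => f (g^-1 * h)%g.

Definition shift_minimal : Prop :=
  forall lam : probability shift_space R, product_lebesgue lam ->
  forall d (X : measurableType d) (mu : probability X R) (a : G -> X -> X),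
    mp_action mu a -> ~ point_mass mu ->
    weakly_contained mu a lam shift -> free_action mu a.

End bernoulli.

(* Main.v *)
Require Import Defs.
From HB Require Import structures.
From mathcomp Require Import all_boot all_order all_algebra finmap.
From mathcomp Require Import zify lra.
From mathcomp Require Import all_classical all_reals all_analysis.
From mathcomp Require Import measurable_realfun.

(* Let N be a non-trivial amenable normal subgroup.  The shift of G on {0,1}^(G/N),
   with i.i.d. coordinates equal to 1 with probability 1/e, is not trivial, and it is
   not free because N acts trivially.  It is weakly contained in the Bernoulli shift,
   being a weak limit of factors of it: for a Folner set K of N, let x(g) = 1 when
   f <= exp(-1/|K|) on all of gK.  The map f |-> x is exactly equivariant, and x is 1
   on a finite set S with probability exp(-|SK|/|K|), which tends to exp(-c) as K runs
   along a Folner sequence, c being the number of cosets of N that meet S.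

   Folner sets come from the invariant mean: if there were none, some finite T in N
   would satisfy |TK| >= 2|K| for every finite K in N, and Hall's theorem would turn
   this into a paradoxical decomposition of N.

   Shift-minimality says nothing unless the product measure lambda^G exists.  The even
   and the odd binary digits of a uniform real number are independent uniform digit
   sequences; splitting off the odd digits repeatedly yields countably many independent
   uniform variables. *)

Set Implicit Arguments.
Unset Strict Implicit.
Unset Printing Implicit Defensive.
Import Order.TTheory GRing.Theory Num.Theory.
Import numFieldNormedType.Exports.
Local Open Scope classical_set_scope.

(** * Hall's theorem *)

Section hall.
Context (I J : choiceType) (A : I -> {fset J}).
Local Open Scope fset_scope.

(** [D] holds the edges deleted so far from the bipartite graph; Hall's condition is followed while
    edges are deleted. *)
Let nbhd (D : set (I * J)) (S : {fset I}) : {fset J} :=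
  [fset y in \bigcup_(i <- S) A i | `[< exists i, [/\ i \in S, y \in A i & ~ D (i, y)] >]].

Let nbhdP D S y : reflect (exists i, [/\ i \in S, y \in A i & ~ D (i, y)]) (y \in nbhd D S).
Proof.
apply: (iffP idP) => [|[i [iS yi Diy]]].
  by rewrite !inE => /andP[_ /asboolP].
rewrite !inE; apply/andP; split; last by apply/asboolP; exists i.
by apply/bigfcupP; exists i; rewrite ?iS.
Qed.

Let hall_cond D := forall S : {fset I}, (#|` S| <= #|` nbhd D S|)%N.

Let chain_finite (F : set (set (I * J))) (L : seq (I * J)) :
    F !=set0 -> total_on F subset ->
  (forall x, x \in L -> (\bigcup_(X in F) X)%classic x) ->
  exists2 D, F D & forall x, x \in L -> D x.
Proof.
move=> [D0 FD0] Ftot; elim: L => [|x L IH] HL; first by exists D0.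
have [|D FD DL] := IH; first by move=> y yL; apply: HL; rewrite inE yL orbT.
have [|E FE Ex] := HL x; first by rewrite inE eqxx.
have [DE|ED] := Ftot _ _ FD FE.
  exists E => // y; rewrite inE => /predU1P[->//|/DL]; exact: DE.
exists D => // y; rewrite inE => /predU1P[->//|/DL//]; exact: ED.
Qed.

(** Hall's condition for one [S] involves only the finitely many edges leaving [S], and those
    deleted by the whole chain are already deleted by one of its members. *)
Let hall_chain (F : set (set (I * J))) : hall_cond set0 ->
  (F `<=` hall_cond)%classic -> total_on F subset -> hall_cond (\bigcup_(X in F) X)%classic.
Proof.
move=> H0 FH Ftot S.
have [->|/set0P F0] := eqVneq F set0; first by rewrite bigcup_set0; exact: H0.
pose L := [seq x <- [seq (i, y) | i <- S, y <- \bigcup_(i <- S) A i]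
          | `[< (\bigcup_(X in F) X)%classic x >]].
have [|D FD DL] := @chain_finite F L F0 Ftot.
  by move=> x; rewrite mem_filter => /andP[/asboolP].
apply: (leq_trans (FH _ FD S)); apply: fsubset_leq_card.
apply/fsubsetP => y /nbhdP[i [iS yi Diy]].
apply/nbhdP; exists i; split => // UFiy; apply: Diy; apply: DL.
rewrite mem_filter; apply/andP; split; first exact/asboolP.
apply/allpairsP; exists (i, y); split => //=.
by apply/bigfcupP; exists i; rewrite ?iS.
Qed.

(* Rado's argument: if both a and b could not be deleted from the list of i, the
   two obstructions S1 and S2 would contradict submodularity of |nbhd|. *)
Let hall_delete D i a b : hall_cond D -> a \in A i -> b \in A i ->
  ~ D (i, a) -> ~ D (i, b) -> a != b ->
  hall_cond (D `|` [set (i, a)])%classic \/ hall_cond (D `|` [set (i, b)])%classic.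
Proof.
move=> HD aA bA Da Db ab; apply: contrapT => /not_orP.
move=> [/existsNP[S1 /negP]]; rewrite -ltnNge => HS1.
move=> /existsNP[S2 /negP]; rewrite -ltnNge => HS2.
have iS c S : (#|` nbhd (D `|` [set (i, c)])%classic S| < #|` S|)%N -> i \in S.
  move=> lt; apply: contraT => iS; move: lt; rewrite ltnNge => /negP; case.
  apply: (leq_trans (HD S)); apply: fsubset_leq_card.
  apply/fsubsetP => y /nbhdP[j [jS yj Dj]].
  apply/nbhdP; exists j; split => // -[//|/= [ji _]].
  by move: iS; rewrite -ji jS.
have iS1 := iS _ _ HS1; have iS2 := iS _ _ HS2.
pose X1 := nbhd (D `|` [set (i, a)])%classic S1.
pose X2 := nbhd (D `|` [set (i, b)])%classic S2.
(* The neighbour [a] that [i] loses in [X1] survives in [X2], because [a != b] and [i] is in [S2];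
   likewise for [b] with the roles exchanged. *)
have hU : nbhd D (S1 `|` S2) `<=` X1 `|` X2.
  apply/fsubsetP => y /nbhdP[j []]; rewrite !in_fsetU => /orP[jS|jS] yj Dj.
    have [[ji ya]|ne] := pselect (j = i /\ y = a).
      apply/orP; right; apply/nbhdP; exists j; split=> //; first by rewrite ji.
      by move=> [//|/= [_ yb]]; move: ab; rewrite -ya yb eqxx.
    apply/orP; left; apply/nbhdP; exists j; split=> //.
    by move=> [//|/= [e1 e2]]; exact: ne.
  have [[ji ya]|ne] := pselect (j = i /\ y = b).
    apply/orP; left; apply/nbhdP; exists j; split=> //; first by rewrite ji.
    by move=> [//|/= [_ yb]]; move: ab; rewrite -ya yb eqxx.
  apply/orP; right; apply/nbhdP; exists j; split=> //.
  by move=> [//|/= [e1 e2]]; exact: ne.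
(* Both deletions concern edges at [i] only, so nothing is lost away from [i]. Submodularity then
   gives |S1| + |S2| - 1 <= |X1| + |X2|, against the two strict inequalities. *)
have hI : nbhd D ((S1 `&` S2) `\ i) `<=` X1 `&` X2.
  apply/fsubsetP => y /nbhdP[j []]; rewrite in_fsetD1 !in_fsetI => /and3P[ji jS1 jS2] yj Dj.
  apply/andP; split; apply/nbhdP; exists j; split => // -[//|/= [e _]];
  by move: ji; rewrite e eqxx.
have := HD (S1 `|` S2); have := HD ((S1 `&` S2) `\ i).
have := fsubset_leq_card hU; have := fsubset_leq_card hI.
have := cardfsUI X1 X2; have := cardfsUI S1 S2.
have := cardfsD1 i (S1 `&` S2); rewrite inE iS1 iS2 /=.
rewrite -/X1 in HS1; rewrite -/X2 in HS2; lia.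
Qed.

(** A set of deletions that is maximal for Hall's condition leaves each [i] exactly one neighbour,
    by [hall_delete]. Hall's condition on pairs makes the resulting map injective. *)
Lemma hall_marriage :
  (forall S : {fset I}, (#|` S| <= #|` \bigcup_(i <- S) A i|)%N) ->
  exists f : I -> J, injective f /\ forall i, f i \in A i.
Proof.
move=> HA; have H0 : hall_cond set0.
  move=> S; apply: (leq_trans (HA S)); apply: fsubset_leq_card.
  apply/fsubsetP => y /bigfcupP[i /andP[iS _] yi].
  by apply/nbhdP; exists i; split.
have [D [HD Dmax]] := Zorn_bigcup (fun F => @hall_chain F H0).
have nb1 i : exists y, y \in A i /\ ~ D (i, y).
  have := HD [fset i]; rewrite cardfs1 cardfs_gt0 => /fset0Pn[y /nbhdP[j []]].
  by rewrite inE => /eqP-> yi Diy; exists y.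
have nb_uniq i a b : a \in A i -> b \in A i -> ~ D (i, a) -> ~ D (i, b) -> a = b.
  move=> aA bA Da Db; apply: contrapT => /eqP ab.
  have prop c : ~ D (i, c) -> (D `<` D `|` [set (i, c)])%classic.
    move=> Dc; split; first by move=> x Dx; left.
    by move=> sub; apply: Dc; apply: sub; right.
  have [H|H] := hall_delete HD aA bA Da Db ab.
    exact: (Dmax _ (prop _ Da) H).
  exact: (Dmax _ (prop _ Db) H).
have [f Hf] := choice nb1.
exists f; split=> [i j fij|i]; last by have [] := Hf i.
apply: contrapT => /eqP ij.
have := HD [fset i; j]; rewrite cardfs2 ij.
suff -> : nbhd D [fset i; j] = [fset f i] by rewrite cardfs1.
have [fi Di] := Hf i; have [fj Dj] := Hf j.
apply/fsetP => y; rewrite in_fset1; apply/nbhdP/eqP => [[k []]|->].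
  rewrite !inE => /orP[]/eqP-> yk Dk; first exact: (nb_uniq i).
  by rewrite fij; exact: (nb_uniq j).
by exists i; rewrite !inE eqxx.
Qed.

End hall.

(** * Folner sets of amenable subgroups *)

Section folner.
Context (R : realType) (G : groupType) (N : set G).
Context (sN : subgroup N).

Lemma subgroup1 : N 1%g. Proof. by case: sN => /set_mem. Qed.

Lemma subgroupV g : N g -> N (g^-1)%g.
Proof. by move=> Ng; apply/set_mem/(group_closedV sN)/mem_set. Qed.

Lemma subgroupM g h : N g -> N h -> N (g * h)%g.
Proof. by move=> Ng Nh; apply/set_mem/(group_closedM sN); exact/mem_set. Qed.

Local Open Scope fset_scope.

Definition mulfs (S K : {fset G}) : {fset G} := [fset (x * y)%g | x in S, y in K].
Definition lmulfs (g : G) (K : {fset G}) : {fset G} := [fset (g * x)%g | x in K].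

Lemma mem_lmulfs g K x : (x \in lmulfs g K) = ((g^-1 * x)%g \in K).
Proof.
apply/imfsetP/idP => [[y /= yK ->]|xK]; first by rewrite mulKg.
by exists (g^-1 * x)%g => //; rewrite mulVKg.
Qed.

Lemma card_lmulfs g K : #|` lmulfs g K| = #|` K|.
Proof. by rewrite card_imfset //; exact: mulgI. Qed.

Lemma mulfsP S K z :
  reflect (exists2 x, x \in S & (x^-1 * z)%g \in K) (z \in mulfs S K).
Proof.
apply: (iffP idP) => [/imfset2P[x /= xS [y /= yK ->]]|[x xS xz]].
  by exists x => //; rewrite mulKg.
by apply/imfset2P; exists x => //; exists (x^-1 * z)%g => //; rewrite mulVKg.
Qed.

Lemma mulfsA S T K : mulfs (mulfs S T) K = mulfs S (mulfs T K).
Proof.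
apply/fsetP => z; apply/mulfsP/mulfsP => [[x /mulfsP[s sS sx] xz]|[s sS /mulfsP[t tT tz]]].
  exists s => //; apply/mulfsP; exists (s^-1 * x)%g => //.
  by rewrite invgM invgK mulgA mulgK.
exists (s * t)%g; last by rewrite invgM -mulgA.
by apply/mulfsP; exists s => //; rewrite mulKg.
Qed.

Lemma mul1fs K : mulfs [fset 1%g] K = K.
Proof.
apply/fsetP => z; apply/mulfsP/idP => [[x]|zK].
  by rewrite inE => /eqP ->; rewrite invg1 mul1g.
by exists 1%g; rewrite ?inE // invg1 mul1g.
Qed.

Definition expfs (S : {fset G}) n := iter n (mulfs S) [fset 1%g].

Lemma expfs_sub S n : {in S, forall x, N x} -> {in expfs S n, forall x, N x}.
Proof.
move=> SN; elim: n => [|n IH] x /=; first by rewrite inE => /eqP ->; exact: subgroup1.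
move=> /mulfsP[s sS xs]; rewrite -(mulVKg s x).
by apply: subgroupM; [exact: SN|exact: IH].
Qed.

Section mean.
Context (m : set G -> R).
Context (mU : forall A B, (A `<=` N)%classic -> (B `<=` N)%classic ->
  (A `&` B)%classic = set0 -> m (A `|` B)%classic = (m A + m B)%R).

Lemma mean_set0 : m set0 = 0%R.
Proof.
have := @mU set0 set0 (@sub0set _ _) (@sub0set _ _) (set0I _).
by rewrite setU0 => /eqP; rewrite -subr_eq subrr => /eqP.
Qed.

Lemma mean_bigcup (T : seq G) (X : G -> set G) : uniq T ->
  (forall t, (X t `<=` N)%classic) ->
  (forall t t' x, t \in T -> t' \in T -> X t x -> X t' x -> t = t') ->
  m (\bigcup_(t in [set` T]) X t)%classic = (\sum_(t <- T) m (X t))%R.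
Proof.
move=> + XN; elim: T => [|t T IH] /=.
  by move=> _ _; rewrite bigcup_seq !big_nil mean_set0.
move=> /andP[tT uT] disj; rewrite bigcup_seq !big_cons -bigcup_seq mU //; first 1 last.
- by move=> x [s _ /XN].
- apply/seteqP; split => // x [Xt [s /= sT Xs]].
  by move: tT; rewrite (disj t s x) ?inE ?eqxx ?sT ?orbT.
by rewrite IH // => s s' x sT s'T; apply: disj; rewrite inE ?sT ?s'T orbT.
Qed.

End mean.

(* Otherwise Hall's theorem gives an injection f of N * bool into N with f (n, b) in T n;
   cutting N according to the element of T used, both f (N, true) and f (N, false) have
   mean 1, although they are disjoint. *)
Lemma amenable_no_doubling (T : {fset G}) : amenable R N ->
  {in T, forall t, N t} ->
  exists K : {fset G}, {in K, forall x, N x} /\ (#|` mulfs T K| < 2 * #|` K|)%N.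
Proof.
move=> [m [m1 m0 mU mI]] TN; apply: contrapT => nK.
have H K : {in K, forall x, N x} -> (2 * #|` K| <= #|` mulfs T K|)%N.
  by move=> KN; rewrite leqNgt; apply/negP => lt; apply: nK; exists K.
pose A (x : set_type N * bool) := mulfs T [fset val x.1].
have [S|f [finj fA]] := @hall_marriage _ _ A.
  pose K := [fset val x.1 | x in S].
  have KN : {in K, forall x, N x}.
    by move=> _ /imfsetP[/= x _ ->]; exact: set_valP.
  have SK : (#|` S| <= 2 * #|` K|)%N.
    rewrite mulnC -(size_allpairs pair K [:: true; false]).
    rewrite -(size_map (fun x : set_type N * bool => (val x.1, x.2))).
    apply: uniq_leq_size.
      by rewrite map_inj_uniq ?fset_uniq // => -[x b] [y c] [/val_inj -> ->].
    move=> _ /mapP[x xS ->]; apply: allpairs_f.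
      by apply/imfsetP; exists x.
    by case: (x.2).
  apply: (leq_trans SK); apply: (leq_trans (H _ KN)).
  apply: fsubset_leq_card; apply/fsubsetP => z /mulfsP[t tT /imfsetP[/= x xS xz]].
  apply/bigfcupP; exists x; rewrite ?xS //.
  by apply/mulfsP; exists t => //; rewrite inE; apply/eqP.
have fP x : exists2 t, t \in T & f x = (t * val x.1)%g.
  have /mulfsP[t tT] := fA x; rewrite inE => /eqP e.
  by exists t => //; rewrite -e mulVKg.
(* [Y b t] collects the n whose copy labelled [b] is sent to t n. For fixed [b] these sets partition
   [N], and by left invariance their translates [Z b t] also have total mean 1. *)
pose Y b t := [set n | exists2 x : set_type N * bool, x.2 = b & n = val x.1 /\ f x = (t * n)%g].
have YN b t : (Y b t `<=` N)%classic.
  by move=> _ [x _ [-> _]]; exact: set_valP.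
pose Z b t := [set (t * n)%g | n in Y b t].
have Ndecomp b : N = (\bigcup_(t in [set` T]) Y b t)%classic.
  apply/seteqP; split=> [n Nn|n [t _ /YN//]].
  have [t tT fe] := fP (SigSub (mem_set Nn), b).
  by exists t => //; exists (SigSub (mem_set Nn), b).
have mY b : (\sum_(t <- T) m (Y b t) = 1)%R.
  rewrite -m1 [in RHS](Ndecomp b) mean_bigcup ?fset_uniq //.
  move=> t t' x _ _ [[[y Hy] b1] /= -> [-> e1]] [[[y' Hy'] b2] /= -> [e e2]].
  have yy : (exist _ y Hy : set_type N) = exist _ y' Hy' by apply: val_inj.
  by move: e1 e2; rewrite /= yy => -> /mulIg.
(* [mean_bigcup] wants sets inside [N] for every index, hence the empty value outside [T]. *)
pose Z' b t := if t \in T then Z b t else set0.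
have Z'N b t : (Z' b t `<=` N)%classic.
  rewrite /Z'; case: ifPn => [tT|_]; last by move=> x [].
  move=> _ [n /YN Nn <-].
  by apply: subgroupM => //; exact: TN.
have mZ b : m (\bigcup_(t in [set` T]) Z' b t)%classic = 1%R.
  rewrite mean_bigcup ?fset_uniq //; last first.
    move=> t t' x tT t'T; rewrite /Z' tT t'T.
    move=> [_ [x1 b1 [-> e1]] <-] [_ [x2 b2 [-> e2]] e3].
    have : f x1 = f x2 by rewrite e1 e2 e3.
    by move=> /finj xx; move: e3; rewrite xx => /mulIg.
  rewrite -(mY b) !big_seq; apply: eq_bigr => t tT.
  by rewrite /Z' tT /Z mI //; exact: TN.
have ZN b : (\bigcup_(t in [set` T]) Z' b t `<=` N)%classic.
  by move=> x [t _ /Z'N].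
have ZZ : (\bigcup_(t in [set` T]) Z' true t `&` \bigcup_(t in [set` T]) Z' false t)%classic = set0.
  apply/seteqP; split => // x [[t /= tT +] [t' /= t'T]]; rewrite /Z' tT t'T.
  move=> [_ [x1 b1 [-> e1]] <-] [_ [x2 b2 [-> e2]] e3].
  have : f x1 = f x2 by rewrite e1 e2 e3.
  by move=> /finj xx; move: b1; rewrite xx b2.
set Z1 := (\bigcup_(t in _) Z' true t)%classic in ZZ.
set Z0 := (\bigcup_(t in _) Z' false t)%classic in ZZ.
have UN : (Z1 `|` Z0 `<=` N)%classic by rewrite subUset; split; exact: ZN.
(* The disjoint sets [Z1] and [Z0] have mean 1 each and the rest of [N] has nonnegative mean, so
   that 2 <= m N = 1. *)
have := @mU (Z1 `|` Z0)%classic (N `\` (Z1 `|` Z0))%classic UN (@subDsetl _ _ _).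
rewrite setDIK setDUK // => /(_ erefl); rewrite mU //; try exact: ZN.
rewrite m1 /Z1 /Z0 !mZ; have := @m0 (N `\` (Z1 `|` Z0))%classic (@subDsetl _ _ _).
lra.
Qed.

(** Bernoulli's inequality for (1 + 1/(k+1))^(k+1): growth by the factor (k+2)/(k+1), repeated k+1
    times, at least doubles. *)
Lemma double_pow (k : nat) : (2 * k.+1 ^ k.+1 <= k.+2 ^ k.+1)%N.
Proof.
have bernoulli a n : (a ^ n.+1 + n.+1 * a ^ n <= a.+1 ^ n.+1)%N.
  elim: n => [|n IH]; first by rewrite !expn1 expn0 muln1 addn1.
  rewrite [(a.+1 ^ n.+2)%N]expnS; apply: leq_trans (leq_mul (leqnn a.+1) IH).
  rewrite [(a ^ n.+2)%N]expnS ![(a ^ n.+1)%N]expnS; nia.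
by apply: leq_trans (bernoulli k.+1 k); rewrite -expnS mul2n addnn.
Qed.

(** If each non-empty finite [K] in [N] were moved by some g of [F] in at least |K|/(k+1) points,
    multiplication by [S] would enlarge finite sets by the factor (k+2)/(k+1). The power of [S] of
    exponent k+1 would then double them all, which [amenable_no_doubling] forbids. *)
Lemma amenable_folner (F : {fset G}) (k : nat) : amenable R N ->
  {in F, forall g, N g} ->
  exists K : {fset G}, [/\ K != fset0, {in K, forall x, N x} &
    {in F, forall g, (k.+1 * #|` lmulfs g K `\` K| < #|` K|)%N}].
Proof.
move=> aN FN; apply: contrapT => nK.
(* The unit is added so that [mulfs S K] contains [K] besides [lmulfs g K]. *)
pose S := 1%g |` F.
have SN : {in S, forall x, N x}.
  by move=> x; rewrite !inE => /predU1P[->|/FN//]; exact: subgroup1.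
have grow (K : {fset G}) : {in K, forall x, N x} ->
    (k.+2 * #|` K| <= k.+1 * #|` mulfs S K|)%N.
  move=> KN; have [->|K0] := eqVneq K fset0; first by rewrite cardfs0 muln0.
  have [g gF gK] : exists2 g, g \in F & (#|` K| <= k.+1 * #|` lmulfs g K `\` K|)%N.
    apply: contrapT => ng; apply: nK; exists K; split => // g gF.
    by rewrite ltnNge; apply/negP => le; apply: ng; exists g.
  have sub : K `|` (lmulfs g K `\` K) `<=` mulfs S K.
    apply/fsubsetP => x; rewrite in_fsetU => /orP[xK|].
      by apply/mulfsP; exists 1%g; rewrite ?invg1 ?mul1g // !inE eqxx.
    rewrite in_fsetD mem_lmulfs => /andP[_ gx].
    by apply/mulfsP; exists g => //; rewrite !inE gF orbT.
  have := fsubset_leq_card sub; rewrite cardfsU.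
  rewrite (_ : K `&` (lmulfs g K `\` K) = fset0); last first.
    by apply/fsetP => x; rewrite !inE; case: (x \in K); rewrite ?andbF.
  rewrite cardfs0; nia.
have growp n (K : {fset G}) : {in K, forall x, N x} ->
    (k.+2 ^ n * #|` K| <= k.+1 ^ n * #|` mulfs (expfs S n) K|)%N.
  move=> KN; elim: n => [|n IH]; first by rewrite mul1fs.
  rewrite [expfs S n.+1]/= mulfsA !expnS -!mulnA.
  have XN : {in mulfs (expfs S n) K, forall x, N x}.
    move=> x /mulfsP[y yS yx]; rewrite -(mulVKg y x).
    by apply: subgroupM; [exact: (expfs_sub SN yS)|exact: KN].
  have := leq_mul (leqnn (k.+1 ^ n)) (grow _ XN); have := leq_mul (leqnn k.+2) IH.
  move=> h1 h2; apply: (leq_trans h1); rewrite mulnCA; apply: (leq_trans h2).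
  by rewrite mulnCA.
have [K [KN]] := @amenable_no_doubling (expfs S k.+1) aN (expfs_sub SN).
have := growp k.+1 K KN; have := double_pow k.
have : (0 < k.+1 ^ k.+1)%N by rewrite expn_gt0.
nia.
Qed.

End folner.

Local Open Scope ring_scope.

(** * Coin tossing and the product of Lebesgue measures *)

Section pushforward.
Context d d' (T1 : measurableType d) (T2 : measurableType d') (R : realType).
Context (f : T1 -> T2) (mf : measurable_fun setT f).

Definition push (m : {measure set T1 -> \bar R}) : {measure set T2 -> \bar R} :=
  measure_function_pushforward__canonical__measure_function_Measure m mf.

Definition mfun_of : {mfun T1 >-> T2} :=
  HB.pack f (isMeasurableFun.Build _ _ _ _ f mf).

Definition push_probability (P : probability T1 R) : probability T2 R :=
  distribution P mfun_of.

Lemma pushE m A : push m A = m (f @^-1` A). Proof. by []. Qed.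

Lemma push_probabilityE P A : push_probability P A = P (f @^-1` A).
Proof. by []. Qed.

Lemma measurable_preimage A : measurable A -> measurable (f @^-1` A).
Proof. by move=> mA; rewrite -[X in measurable X]setTI; exact: mf. Qed.

End pushforward.

(** * The measurable space {0,1}^I and its cylinders *)

Definition cube_sets (I : Type) : set (set (I -> bool)) :=
  [set A | exists i, A = [set x : I -> bool | x i]].

Definition cube (I : Type) := g_sigma_algebraType (@cube_sets I).

(** Only the value [true] is prescribed. These sets still form a pi-system generating the
    sigma-algebra, so they determine a finite measure. *)
Definition cyl (I : eqType) (s : seq I) : set (cube I) :=
  [set x | forall i, i \in s -> x i].

Lemma cyl_nil (I : eqType) : cyl (I := I) [::] = setT.
Proof. by apply/seteqP; split. Qed.

Lemma cyl_cons (I : eqType) i (s : seq I) :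
  cyl (i :: s) = [set x : cube I | x i] `&` cyl s.
Proof.
apply/seteqP; split => [x Hx|x [xi Hx] j].
  split; first by apply: Hx; rewrite inE eqxx.
  by move=> j js; apply: Hx; rewrite inE js orbT.
by rewrite inE => /predU1P[->//|]; exact: Hx.
Qed.

Lemma cyl_cat (I : eqType) (s t : seq I) : cyl (s ++ t) = cyl s `&` cyl t.
Proof.
elim: s => [|i s IH]; first by rewrite cyl_nil setTI.
by rewrite cat_cons !cyl_cons IH setIA.
Qed.

Lemma measurable_coord (I : Type) (i : I) : measurable [set x : cube I | x i].
Proof. by apply: sub_sigma_algebra; exists i. Qed.

Lemma measurable_cyl (I : eqType) (s : seq I) : measurable (cyl s).
Proof.
elim: s => [|i s IH]; first by rewrite cyl_nil; exact: measurableT.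
by rewrite cyl_cons; apply: measurableI => //; exact: measurable_coord.
Qed.

Lemma cube_measurable_fun (I : Type) d (T : measurableType d) (f : T -> cube I) :
  (forall i, measurable [set t | f t i]) -> measurable_fun setT f.
Proof.
move=> mf; apply: (@measurability _ _ T (cube I) setT f (@cube_sets I)) => // _ [_ [i ->] <-].
by rewrite setTI; exact: mf.
Qed.

Lemma cube_measure_unique (R : realType) (I : eqType)
    (m1 m2 : {measure set (cube I) -> \bar R}) :
  (m1 setT < +oo)%E -> (forall s : seq I, m1 (cyl s) = m2 (cyl s)) ->
  forall A, measurable A -> m1 A = m2 A.
Proof.
move=> m1oo m12 A mA.
apply: (measure_unique [set X | exists s, X = cyl s] (fun=> setT)) => //.
- apply/seteqP; split; last first.
    apply: smallest_sub; first exact: sigma_algebra_measurable.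
    by move=> _ [s ->]; exact: measurable_cyl.
  apply: sub_smallest2r => // _ [i ->]; exists [:: i].
  apply/seteqP; split => x /= Hx; last by apply: Hx; rewrite inE.
  by move=> j; rewrite inE => /eqP ->.
- by move=> _ _ [s ->] [t ->]; exists (s ++ t); rewrite cyl_cat.
- by move=> _; exists [::]; rewrite cyl_nil.
- by rewrite bigcup_const.
- by move=> _ [s ->].
Qed.

(** * Binary digits of a uniform real number *)

Section uniform_bits.
Context (R : realType).
Local Notation lambda := (@lebesgue_measure R).

(** Twice the image of Lebesgue measure under x -> 2x + c gives each half-open interval its length,
    which characterizes Lebesgue measure. *)
Lemma lebesgue_measure_affine (c : R) (E : set R) : measurable E ->
  (lambda E = 2%:E * lambda [set x : R | E (2 * x + c)%R])%E.
Proof.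
move=> mE.
have mf : measurable_fun setT (fun x : R => 2 * x + c).
  have m2 : measurable_fun setT (fun x : R => 2 * x).
    exact: (@measurable_funM _ _ _ _ (fun=> 2) (fun x => x)).
  exact: (measurable_funD m2 (measurable_cst c)).
have mf' : @measurable_fun _ _ (measurableTypeR R) (measurableTypeR R) setT
  (fun x : R => 2 * x + c) := mf.
pose m := mscale (NngNum (ler0n R 2)) (push mf' lambda).
transitivity (m E); last by [].
apply: (lebesgue_measure_unique (mu := m)) => // _ [[a b] _ <-] /=.
rewrite /m /mscale /= /pushforward /=.
rewrite (_ : _ @^-1` _ = `](a - c) / 2, (b - c) / 2]%classic); last first.
  by apply/seteqP; split => x /=; rewrite !in_itv /= => /andP[? ?]; apply/andP; split; lra.
rewrite !lebesgue_measure_itv /= !lte_fin ltr_pM2r ?invr_gt0 // ltrD2r.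
case: ifPn => // _; last by rewrite mule0.
rewrite -?EFinN -?EFinD -EFinM; congr (_%:E). lra.
Qed.

Let itv := `[(0 : R), 1[%classic.
Let mitv : measurable itv. Proof. exact: measurable_itv. Qed.
Definition unif := mrestr lambda mitv.
HB.instance Definition _ := Measure.on unif.

Let unif_setT : unif setT = 1%E.
Proof.
by rewrite /unif /mrestr setTI lebesgue_measure_itv /= lte_fin ltr01 oppr0 adde0.
Qed.
HB.instance Definition _ := Measure_isProbability.Build _ _ _ unif unif_setT.

(** On [0,1[ this is x -> 2x mod 1, which drops the first binary digit. *)
Definition dbl (x : R) : R := if x < 2^-1 then 2 * x else 2 * x - 1.

Lemma measurable_dbl : measurable_fun setT dbl.
Proof.
apply: measurable_fun_ifT.
- exact: measurable_fun_ltr.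
- exact: measurable_funM.
- by apply: measurable_funB => //; exact: measurable_funM.
Qed.

(** Each half of [0,1[ is mapped affinely onto [0,1[. In other words, the first digit is a fair coin
    independent of the remaining ones. *)
Lemma unif_dbl b (E : set R) : measurable E ->
  (unif E = 2%:E * unif ([set x : R | (2^-1 <= x)%R = b] `&` dbl @^-1` E))%E.
Proof.
(* The upper half, [b = true], uses the branch x -> 2x - 1, the lower half x -> 2x. *)
move=> mE; rewrite /unif /mrestr (lebesgue_measure_affine (if b then -1 else 0)) //; last first.
  exact: measurableI.
congr (_ * lambda _)%E; apply/seteqP; split => x /=;
  rewrite /itv /dbl /= !in_itv /=; case: b; case: (ltP x 2^-1) => /= h.
- by move=> [_ /andP[? ?]]; lra.
- by move=> [Ex /andP[? ?]]; split => //; apply/andP; split; lra.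
- by rewrite addr0 => -[Ex /andP[? ?]]; split => //; apply/andP; split; lra.
- by rewrite addr0 => -[Ex /andP[? ?]]; lra.
- by move=> [[]].
- by move=> [[_ Ex] /andP[? ?]]; split => //; apply/andP; split; lra.
- by move=> [[_ Ex] /andP[? ?]]; rewrite addr0; split => //; apply/andP; split; lra.
- by move=> [[]].
Qed.

Definition bits (x : measurableTypeR R) : cube nat := fun k => 2^-1 <= iter k dbl x.

Lemma measurable_iter_dbl k : measurable_fun setT (iter k dbl).
Proof.
elim: k => [|k IH] /=; first exact: measurable_id.
exact: (measurableT_comp measurable_dbl IH).
Qed.

Lemma measurable_bitsk k : measurable [set x : R | bits x k].
Proof.
have := measurable_fun_ler (@measurable_cst _ _ R R setT 2^-1) (measurable_iter_dbl k).
move=> /(_ measurableT [set true] I).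
by rewrite setTI; congr measurable; apply/seteqP; split.
Qed.

Lemma measurable_bits : measurable_fun setT bits.
Proof.
by apply: (@cube_measurable_fun nat _ (measurableTypeR R)) => k; exact: measurable_bitsk.
Qed.

(** Induction by removing the first digit: the later digits of x are the digits of [dbl x], and
    [unif_dbl] accounts for the first. [P] marks the prescribed digits. *)
Lemma unif_bits n (P : pred nat) :
  unif [set x | forall k, (k < n)%N -> P k -> bits x k] =
  ((2^-1) ^+ count P (iota 0 n))%:E.
Proof.
elim: n P => [|n IH] P.
  rewrite (_ : [set _ | _] = setT); last by apply/seteqP; split.
  by rewrite expr0; exact: probability_setT.
pose E := [set x | forall k, (k < n)%N -> P k.+1 -> bits x k].
have mE : measurable E.
  rewrite (_ : E = \bigcap_(k in [set k | (k < n)%N /\ P k.+1]) [set x | bits x k]).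
    by apply: bigcap_measurableType => k _; exact: measurable_bitsk.
  by apply/seteqP; split => x Ex k; [move=> [kn Pk]; exact: Ex|move=> kn Pk; exact: Ex].
have IHE : unif E = ((2^-1) ^+ count P (iota 1 n))%:E.
  rewrite IH -[1%N]addn0 iotaDl count_map; congr (_ ^+ _)%:E.
have mB b : measurable [set x : R | (2^-1 <= x) = b].
  have := measurable_fun_ler (@measurable_cst _ _ R R setT 2^-1) (@measurable_id _ R setT).
  by move=> /(_ measurableT [set b] I); rewrite setTI.
have mdE : measurable (dbl @^-1` E).
  by have := measurable_dbl measurableT mE; rewrite setTI.
have H b : unif ([set x : R | (2^-1 <= x)%R = b] `&` dbl @^-1` E) =
    (2^-1 * (2^-1) ^+ count P (iota 1 n))%:E.
  have := unif_dbl b mE; rewrite IHE.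
  have /fineK <- : unif ([set x : R | (2^-1 <= x)%R = b] `&` dbl @^-1` E) \is a fin_num.
    by apply: fin_num_measure; exact: (measurableI _ _ (mB b) mdE).
  by rewrite -EFinM => -[->]; rewrite mulKf // pnatr_eq0.
rewrite [iota 0 n.+1]/= [count _ _]/=; case: (boolP (P 0%N)) => P0.
  rewrite add1n exprS -(H true); congr (unif _).
  apply/seteqP; split => x /=.
    move=> Hx; split; first exact: (Hx 0%N).
    by move=> k kn Pk; have := Hx k.+1 kn Pk; rewrite /bits iterSr.
  by move=> [x0 Hx] [|k] kn Pk //; have := Hx k kn Pk; rewrite /bits iterSr.
(* When digit 0 is free, both halves contribute, and the two factors 1/2 add up to 1. *)
rewrite add0n (_ : [set _ | _] =
  ([set x : R | (2^-1 <= x)%R = true] `&` dbl @^-1` E) `|`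
  ([set x : R | (2^-1 <= x)%R = false] `&` dbl @^-1` E)).
  transitivity (unif ([set x : R | (2^-1 <= x)%R = true] `&` dbl @^-1` E) +
                unif ([set x : R | (2^-1 <= x)%R = false] `&` dbl @^-1` E))%E.
    apply: measureU; [exact: (measurableI _ _ (mB _) mdE)..|].
    by apply/seteqP; split => // x /= [[-> _] []].
  by rewrite (H true) (H false) -EFinD mulrC -splitr.
rewrite -setIUl (_ : _ `|` _ = setT) ?setTI.
  apply/seteqP; split => x /= Hx.
    by move=> k kn Pk; have := Hx k.+1 kn Pk; rewrite /bits iterSr.
  move=> [|k] kn Pk; first by rewrite Pk in P0.
  by have := Hx k kn Pk; rewrite /bits iterSr.
by apply/seteqP; split => // x _ /=; case: (_ <= _); [left|right].
Qed.

Definition coin : probability (cube nat) R := push_probability measurable_bits unif.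

Lemma coin_cyl (s : seq nat) : uniq s -> coin (cyl s) = ((2^-1) ^+ size s)%:E.
Proof.
move=> us; pose n := (\max_(i <- s) i).+1.
have sn k : k \in s -> (k < n)%N by move=> ks; rewrite ltnS; exact: leq_bigmax_seq.
rewrite push_probabilityE.
rewrite (_ : _ @^-1` _ = [set x | forall k, (k < n)%N -> k \in s -> bits x k]); last first.
  apply/seteqP; split => x /= Hx k; first by move=> _; exact: Hx.
  by move=> ks; apply: Hx => //; exact: sn.
transitivity ((2^-1 : R) ^+ count (mem s) (iota 0 n))%:E; first exact: (unif_bits n (mem s)).
rewrite -size_filter; congr (_ ^+ _)%:E.
apply/perm_size/uniq_perm; rewrite ?filter_uniq ?iota_uniq // => k.
rewrite mem_filter mem_iota add0n /=.
by case: (boolP (k \in s)) => // /sn ->.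
Qed.

(** * Splitting a digit sequence into independent rows *)

Definition evens (z : cube nat) : cube nat := fun k => z k.*2.
Definition odds (z : cube nat) : cube nat := fun k => z k.*2.+1.

Lemma measurable_evens : measurable_fun setT evens.
Proof. by apply: cube_measurable_fun => i; exact: measurable_coord. Qed.

Lemma measurable_odds : measurable_fun setT odds.
Proof. by apply: cube_measurable_fun => i; exact: measurable_coord. Qed.

Lemma cyl_undup (I : eqType) (s : seq I) : cyl (undup s) = cyl s.
Proof. by apply/seteqP; split => x Hx i ?; apply: Hx; rewrite ?mem_undup // -mem_undup. Qed.

(** For cylinders this is [coin_cyl]. With one argument fixed, both sides are finite measures in the
    other, so [cube_measure_unique] extends the formula first to all [A], then to all [B]. *)
Lemma coin_evens_odds (A B : set (cube nat)) : measurable A -> measurable B ->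
  coin (evens @^-1` A `&` odds @^-1` B) = (coin A * coin B)%E.
Proof.
have mev A' := @measurable_preimage _ _ _ _ _ measurable_evens A'.
have mod' A' := @measurable_preimage _ _ _ _ _ measurable_odds A'.
have cyls (s t : seq nat) :
    coin (evens @^-1` cyl s `&` odds @^-1` cyl t) = (coin (cyl s) * coin (cyl t))%E.
  rewrite -(cyl_undup s) -(cyl_undup t) !coin_cyl ?undup_uniq // -EFinM -exprD.
  rewrite (_ : _ `&` _ = cyl ([seq k.*2 | k <- undup s] ++ [seq k.*2.+1 | k <- undup t])).
    rewrite coin_cyl ?size_cat ?size_map // cat_uniq !map_inj_uniq ?undup_uniq.
    - rewrite andbT; apply/hasPn => _ /mapP[k _ ->]; apply/negP => /mapP[j _].
      by move=> /(congr1 odd); rewrite /= !odd_double.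
    - by move=> i j /= /eq_add_S /double_inj.
    - exact: double_inj.
  rewrite cyl_cat; congr (_ `&` _); apply/seteqP; split => z Hz k.
  - by move=> /mapP[j js ->]; exact: Hz.
  - by move=> ks; apply: Hz; exact: map_f.
  - by move=> /mapP[j js ->]; exact: Hz.
  - by move=> ks; apply: (Hz k.*2.+1); exact: (map_f (fun k => k.*2.+1)).
(* [mscale] takes a nonnegative real factor, so values of [coin] have to be presented as such. *)
have cm (D : set (cube nat)) : measurable D ->
    exists r : {nonneg R}, coin D = (r%:num)%:E.
  move=> mD; have r0 : 0 <= fine (coin D) by apply: fine_ge0; exact: measure_ge0.
  exists (NngNum r0); apply/esym/fineK.
  by rewrite fin_num_measure.
have fin (D : set (cube nat)) : measurable D -> (coin D < +oo)%E.
  by move=> mD; apply: le_lt_trans (probability_le1 coin mD) (ltry 1).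
have step1 (t : seq nat) D : measurable D ->
    coin (evens @^-1` D `&` odds @^-1` cyl t) = (coin D * coin (cyl t))%E.
  move=> mD; have [r Hr] := cm _ (measurable_cyl t).
  pose m1 := push measurable_evens (mrestr coin (mod' _ (measurable_cyl t))).
  suff h : m1 D = mscale r coin D by rewrite Hr muleC; exact: h.
  apply: cube_measure_unique => // [|s].
    exact: (fin _ (measurableI _ _ (mev _ measurableT) (mod' _ (measurable_cyl t)))).
  rewrite -[LHS]/(coin (evens @^-1` cyl s `&` odds @^-1` cyl t)) cyls Hr muleC.
  by [].
move=> mA mB; have [r Hr] := cm _ mA.
pose m1 := push measurable_odds (mrestr coin (mev _ mA)).
suff h : m1 B = mscale r coin B by rewrite Hr setIC; exact: h.
apply: cube_measure_unique => // [|s].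
  exact: (fin _ (measurableI _ _ (mod' _ measurableT) (mev _ mA))).
rewrite -[LHS]/(coin (odds @^-1` cyl s `&` evens @^-1` A)) setIC step1 // Hr.
by [].
Qed.

(** Row [i] consists of the digits of index 2^i (2k+1) - 1, so distinct rows use disjoint sets of
    digits. *)
Definition rown (i : nat) (z : cube nat) : cube nat := evens (iter i odds z).

Lemma measurable_rown i : measurable_fun setT (rown i).
Proof.
apply: (measurableT_comp measurable_evens).
elim: i => [|i IH] /=; first exact: measurable_id.
exact: (measurableT_comp measurable_odds IH).
Qed.

Lemma measurable_rows (E : nat -> set (cube nat)) n : (forall i, measurable (E i)) ->
  measurable [set z | forall i, (i < n)%N -> E i (rown i z)].
Proof.
move=> mE; rewrite (_ : [set _ | _] = \bigcap_(i in [set i | (i < n)%N]) (rown i @^-1` E i)) //.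
apply: bigcap_measurableType => i _; apply: measurable_preimage => //.
exact: measurable_rown.
Qed.

(** Row 0 is [evens] and the later rows are the rows of [odds], so [coin_evens_odds] splits off one
    factor at a time. *)
Lemma coin_rows (E : nat -> set (cube nat)) n : (forall i, measurable (E i)) ->
  coin [set z | forall i, (i < n)%N -> E i (rown i z)] = (\prod_(0 <= i < n) coin (E i))%E.
Proof.
elim: n E => [|n IH] E mE.
  rewrite big_geq // (_ : [set _ | _] = setT) ?probability_setT //.
  by apply/seteqP; split.
have mE' := @measurable_rows (fun i => E i.+1) n (fun i => mE i.+1).
rewrite big_nat_recl // -(IH (fun i => E i.+1)) // -(coin_evens_odds (mE 0%N) mE').
congr (coin _); apply/seteqP; split => z /= Hz.
  split; first exact: (Hz 0%N).
  by move=> i ni; have := Hz i.+1 ni; rewrite /rown iterSr.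
move=> [|i] ni; first exact: Hz.1.
by have := Hz.2 i ni; rewrite /rown iterSr.
Qed.

Lemma coin_rows_seq (E : nat -> set (cube nat)) s : uniq s -> (forall i, measurable (E i)) ->
  coin [set z | forall i, i \in s -> E i (rown i z)] = (\prod_(i <- s) coin (E i))%E.
Proof.
move=> us mE; pose n := (\max_(i <- s) i).+1.
have sn k : k \in s -> (k < n)%N by move=> ks; rewrite ltnS; exact: leq_bigmax_seq.
pose E' i := if i \in s then E i else setT.
have mE' i : measurable (E' i) by rewrite /E'; case: ifP => // _; exact: measurableT.
rewrite (_ : [set _ | _] = [set z | forall i, (i < n)%N -> E' i (rown i z)]); last first.
  apply/seteqP; split => z Hz i; rewrite /E'.
    by move=> _; case: ifPn => // /Hz.
  by move=> js; have := Hz i (sn _ js); rewrite /E' js.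
rewrite coin_rows //.
rewrite (eq_bigr (fun i => if i \in s then coin (E i) else 1%E)); last first.
  by move=> i _; rewrite /E'; case: ifP => // _; exact: probability_setT.
rewrite -big_mkcond -big_filter; apply: perm_big.
apply: uniq_perm; rewrite ?filter_uniq ?iota_uniq // => k.
rewrite mem_filter mem_index_iota /=.
by case: (boolP (k \in s)) => // /sn ->.
Qed.

End uniform_bits.

Lemma injective_left_inverse (G : groupType) (T : Type) (f : G -> T) :
  injective f -> exists j : T -> G, cancel f j.
Proof.
move=> f_inj; have jP i : exists h, forall g, f g = i -> h = g.
  have [[g gi]|ni] := pselect (exists g, f g = i).
    by exists g => g' g'i; apply: f_inj; rewrite gi.
  by exists 1%g => g gi; exfalso; apply: ni; exists g.
by have [j Hj] := choice jP; exists j => g; exact: Hj.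
Qed.

(** * Uniform reals from coin tosses and existence of the product measure *)

Section product_lebesgue.
Context (R : realType).

Definition binsum (z : cube nat) (n : nat) : R :=
  \sum_(0 <= k < n) (z k)%:R * 2^-1 ^+ k.+1.

Definition binval (z : cube nat) : R := limn (binsum z).

Let binsum_le1 z n : 0 <= binsum z n <= 1 - 2^-1 ^+ n.
Proof.
elim: n => [|n /andP[H0 H1]]; first by rewrite /binsum big_geq // expr0 subrr lexx.
rewrite /binsum big_nat_recr //= -/(binsum z n) exprS.
have h : 0 <= 2^-1 ^+ n :> R by apply: exprn_ge0.
by case: (z n) => /=; rewrite ?mul1r ?mul0r; apply/andP; split; lra.
Qed.

Let binsum_nd z : nondecreasing_seq (binsum z).
Proof.
apply/nondecreasing_seqP => n; rewrite /binsum big_nat_recr //= lerDl.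
by apply: mulr_ge0 => //; apply: exprn_ge0.
Qed.

Let expn_half_ge0 n : 0 <= 2^-1 ^+ n :> R.
Proof. exact: exprn_ge0. Qed.

Let is_cvg_binsum z : cvgn (binsum z).
Proof.
apply: nondecreasing_is_cvgn; first exact: binsum_nd.
exists 1 => _ [n _ <-].
by have /andP[_ h] := binsum_le1 z n; apply: (le_trans h); rewrite lerBlDr lerDl.
Qed.

Lemma binval_itv z : 0 <= binval z <= 1.
Proof.
apply/andP; split.
  apply: limr_ge => //; apply: nearW => n.
  by have /andP[] := binsum_le1 z n.
apply: limr_le => //; apply: nearW => n.
by have /andP[_ h] := binsum_le1 z n; apply: (le_trans h); rewrite lerBlDr lerDl.
Qed.

Lemma measurable_binval : measurable_fun setT binval.
Proof.
apply: (measurable_fun_cvg (h := fun n z => binsum z n)) => [n|z _].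
  rewrite /binsum; apply: measurable_sum => k.
  apply: measurable_funM; last exact: measurable_cst.
  rewrite (_ : (fun _ => _) = (fun z : cube nat => if z k then 1 else 0)); last first.
    by apply/funext => z; case: (z k).
  apply: measurable_fun_ifT; [|exact: measurable_cst..].
  apply: (@measurable_fun_bool _ _ _ _ true); rewrite setTI.
  exact: measurable_coord.
exact: is_cvg_binsum.
Qed.

(** After n digits the remainder of x is 2^-n times the n-th iterate of [dbl], which stays in
    [0,1[. *)
Lemma binval_bits x : 0 <= x < 1 -> binval (bits x) = x.
Proof.
move=> x01; have H n : x = binsum (bits x) n + 2^-1 ^+ n * iter n (@dbl R) x /\
    0 <= iter n (@dbl R) x < 1.
  elim: n => [|n [IH /andP[y0 y1]]]; first by rewrite /binsum big_geq // expr0 mul1r add0r.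
  rewrite /binsum big_nat_recr //= -/(binsum (bits x) n) {1}IH.
  rewrite {3}/bits /dbl; set y := iter n _ x in y0 y1 *.
  rewrite exprS; case: ltP => h /=; (split; last by apply/andP; split; lra); lra.
apply/cvg_lim => //.
apply: (@squeeze_cvgr _ _ _ _ (fun n => x - 2^-1 ^+ n) (cst x)).
- apply: nearW => n; have [e /andP[y0 y1]] := H n.
  have h := expn_half_ge0 n.
  apply/andP; split; last by rewrite /cst [leRHS]e lerDl mulr_ge0.
  by rewrite lerBlDr {1}e lerD2l ler_piMr // ltW.
- rewrite -[X in _ --> X]subr0; apply: cvgB; first exact: cvg_cst.
  apply: cvg_expr; rewrite ger0_norm ?invr_ge0 // invf_lt1 ?ltr1n //.
- exact: cvg_cst.
Qed.

(** As [coin] is the law of the digits of a uniform point of [0,1[, [binval_bits] turns the left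
    side into Lebesgue measure on [0,1[. The closed interval adds only the null set {1}. *)
Lemma coin_binval (C : set R) : measurable C ->
  coin R (binval @^-1` C) = unit_lebesgue (sval @^-1` C : set (unit_itv R)).
Proof.
move=> mC; rewrite /unit_lebesgue.
have -> : [set sval x | x in (sval @^-1` C : set (unit_itv R))] = C `&` `[0, 1]%classic.
  apply/seteqP; split => [_ [[x x01] /= Cx <-]|x [Cx]] //=.
  by rewrite in_itv /= => x01; exists (exist _ x x01).
transitivity (lebesgue_measure (C `&` `[0, 1[%classic)).
  rewrite push_probabilityE /unif /mrestr; congr (lebesgue_measure _).
  by apply/seteqP; split => x /= []; rewrite in_itv /= => + x01; rewrite binval_bits.
apply/esym; have -> : C `&` `[0, 1]%classic = (C `&` `[0, 1[%classic) `|` (C `&` [set 1]).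
  rewrite -setIUr; congr (_ `&` _); apply/seteqP; split => x /=; rewrite !in_itv /=.
    move=> /andP[x0]; rewrite le_eqVlt => /predU1P[->|x1]; first by right.
    by left; rewrite x0 x1.
  by move=> [/andP[-> /ltW ->]|->] //; rewrite ler01 lexx.
have m1 : measurable (C `&` `[0, 1[%classic) by apply: measurableI.
have m2 : measurable (C `&` [set (1 : R)]) by apply: measurableI.
set C1 := C `&` `[0, 1[%classic in m1 *; set C2 := C `&` [set 1] in m2 *.
transitivity (lebesgue_measure C1 + lebesgue_measure C2)%E.
  apply: measureU; [exact: m1|exact: m2|].
  apply/seteqP; split => x //= [[_ +] [_ x1]]; by rewrite x1 /= in_itv /= ltxx andbF.
suff -> : lebesgue_measure C2 = 0%E by rewrite adde0.
apply/eqP; rewrite eq_le measure_ge0 andbT.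
rewrite -(lebesgue_measure_set1 (1 : R)); apply: le_measure; rewrite ?inE //.
exact: subIsetr.
Qed.

Context (G : groupType) (iota : G -> nat) (iota_inj : injective iota).

Definition uniform_seq (z : cube nat) : shift_space R G :=
  fun g => exist _ (binval (rown (iota g) z)) (binval_itv _).

Lemma measurable_uniform_seq : measurable_fun setT uniform_seq.
Proof.
apply: (@measurability _ _ (cube nat) (shift_space R G) setT _ (@coordinate_sets R G)) => //.
move=> _ [_ [g [_ [[C mC ->] ->]]] <-]; rewrite setTI.
have := measurableT_comp measurable_binval (measurable_rown (iota g)).
by move=> /(_ measurableT C mC); rewrite setTI.
Qed.

Lemma exists_product_lebesgue :
  exists lam : probability (shift_space R G) R, product_lebesgue lam.
Proof.
exists (push_probability measurable_uniform_seq (coin R)) => s B us mB.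
have BC g : exists D : set R, measurable D /\ B g = sval @^-1` D.
  by have [D mD ->] := mB g; exists D.
have [C HC] := choice BC.
have [j Hj] := injective_left_inverse iota_inj.
(* Row [i] receives the condition of the element numbered [i]; where no element has that number
   [j i] is arbitrary, but only the rows of elements of [s] are tested. *)
pose E i := binval @^-1` C (j i).
have mE i : measurable (E i).
  by apply: measurable_preimage; [exact: measurable_binval|exact: (HC _).1].
have := @coin_rows_seq R E [seq iota g | g <- s] _ mE.
rewrite map_inj_uniq // big_map => /(_ us) h.
rewrite push_probabilityE (eq_bigr (fun g => coin R (E (iota g)))); last first.
  by move=> g _; rewrite /E Hj (HC g).2 coin_binval //; exact: (HC g).1.
rewrite -h; congr (coin R _); apply/seteqP; split => z /=.
  by move=> Hz _ /mapP[g gs ->]; have := Hz g gs; rewrite (HC g).2 /E /preimage /= Hj.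
move=> Hz g gs; have := Hz (iota g) (map_f _ gs).
by rewrite (HC g).2 /E /preimage /= Hj.
Qed.

End product_lebesgue.

(** * The Cantor cube as a standard Borel space *)

Definition agree (I : Type) (iota : I -> nat) (n : nat) (x y : I -> bool) : Prop :=
  forall i, (iota i < n)%N -> x i = y i.

Section cube_dist.
Context (R : realType) (I : Type) (iota : I -> nat).
Local Notation agree := (agree iota).

Let agree_all x y : (forall n, agree n x y) -> x = y.
Proof. by move=> H; apply/funext => i; exact: (H (iota i).+1). Qed.

Let agree_le m n x y : (m <= n)%N -> agree n x y -> agree m x y.
Proof. by move=> mn H i im; apply: H; exact: leq_trans mn. Qed.

(** The disjunct [x = y] lets the search end for equal points too, for which [cube_dist] has its own
    case. *)
Lemma first_diff_subproof x y : exists n, `[< x = y \/ ~ agree n.+1 x y >].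
Proof.
apply: contrapT => H; apply: H.
have [->|xy] := pselect (x = y); first by exists 0%N; apply/asboolP; left.
apply: contrapT => H; apply: xy; apply: agree_all => -[|n] //.
by apply: contrapT => nxy; apply: H; exists n; apply/asboolP; right.
Qed.

Definition first_diff x y := ex_minn (first_diff_subproof x y).

Definition cube_dist (x y : I -> bool) : R :=
  if `[< x = y >] then 0 else 2^-1 ^+ first_diff x y.

(** Separation, symmetry and the triangle inequality are deduced from this, agreement up to a given
    level being an equivalence relation. *)
Lemma cube_dist_le x y n : cube_dist x y <= 2^-1 ^+ n <-> agree n x y.
Proof.
rewrite /cube_dist; case: asboolP => [->|xy].
  by split => // _; exact: exprn_ge0.
rewrite ler_iXn2l ?invr_gt0 // ?invf_lt1 ?ltr1n //.
rewrite /first_diff; case: ex_minnP => m /asboolP[//|nm] minm; split => [nm'|Hn].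
  apply: contrapT => Hn.
  case: n nm' Hn => [|n] nm' Hn; first exact: Hn.
  have := minm n; rewrite leqNgt nm' => H; have /H // : `[< x = y \/ ~ agree n.+1 x y >].
  by apply/asboolP; right.
by rewrite leqNgt; apply/negP => mn; apply: nm; exact: agree_le Hn.
Qed.

Lemma cube_dist0 x y : cube_dist x y = 0 -> x = y.
Proof.
move=> d0; apply: agree_all => n; apply/cube_dist_le.
by rewrite d0; exact: exprn_ge0.
Qed.

Lemma cube_distxx x : cube_dist x x = 0.
Proof. by rewrite /cube_dist; case: asboolP. Qed.

Lemma cube_dist_pow x y : x <> y -> exists n, cube_dist x y = 2^-1 ^+ n.
Proof. by move=> xy; rewrite /cube_dist; case: asboolP => // _; eexists. Qed.

Lemma cube_dist_sym x y : cube_dist x y = cube_dist y x.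
Proof.
wlog suff : x y / cube_dist x y <= cube_dist y x.
  by move=> H; apply/eqP; rewrite eq_le !H.
have [->|xy] := pselect (x = y); first by [].
have [n e] := cube_dist_pow (nesym xy).
have /cube_dist_le yx : cube_dist y x <= 2^-1 ^+ n by rewrite e.
by rewrite e; apply/cube_dist_le => i im; apply/esym/yx.
Qed.

Lemma cube_dist_triangle y x z : cube_dist x z <= cube_dist x y + cube_dist y z.
Proof.
have [->|xy] := pselect (x = y); first by rewrite cube_distxx add0r.
have [->|yz] := pselect (y = z); first by rewrite cube_distxx addr0.
have [m em] := cube_dist_pow xy; have [n en] := cube_dist_pow yz.
have /cube_dist_le am : cube_dist x y <= 2^-1 ^+ m by rewrite em.
have /cube_dist_le an : cube_dist y z <= 2^-1 ^+ n by rewrite en.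
have : cube_dist x z <= 2^-1 ^+ minn m n.
  apply/cube_dist_le => i; rewrite ltn_min => /andP[im ni].
  by rewrite am // an.
move=> /le_trans; apply; rewrite em en.
have := exprn_ge0 m (_ : 0 <= 2^-1 :> R); have := exprn_ge0 n (_ : 0 <= 2^-1 :> R).
rewrite invr_ge0 ler0n => /(_ isT) ? /(_ isT) ?.
by case: (leqP m n) => _; [rewrite lerDl|rewrite lerDr].
Qed.

End cube_dist.

(** A copy of [I -> bool] under a name that records [R] and [iota], on which the metric depends. *)
Definition cube_metric (R : realType) (I : Type) (iota : I -> nat) : Type := I -> bool.

HB.instance Definition _ (R : realType) (I : Type) (iota : I -> nat) :=
  Choice.copy (cube_metric R iota) (I -> bool).

HB.instance Definition _ (R : realType) (I : Type) (iota : I -> nat) :=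
  isMetric.Build R (cube_metric R iota) (cube_distxx R iota) (@cube_dist0 R I iota)
    (cube_dist_sym R iota) (cube_dist_triangle R iota).

Section cube_standard.
Context (R : realType) (I : Type) (iota : I -> nat) (iota_inj : injective iota).
Local Notation M := (cube_metric R iota).

Let half_cvg e : 0 < e -> exists n, 2^-1 ^+ n < e :> R.
Proof.
move=> e0.
have : (fun n => (2^-1 : R) ^+ n) @ \oo --> (0 : R).
  by apply: cvg_expr; rewrite ger0_norm ?invr_ge0 // invf_lt1 ?ltr1n.
move=> /cvgr_lt /(_ _ e0) [n _ Hn]; exists n; exact: Hn (leqnn n).
Qed.

Let ballE (x : M) e : ball x e = [set y | cube_dist R iota x y < e].
Proof. by rewrite ballEmdist. Qed.

Let ball_agree (x : M) n y : ball x (2^-1 ^+ n) y -> agree iota n x y.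
Proof. by rewrite ballE /= => /ltW /cube_dist_le. Qed.

Let agree_ball (x : M) e : 0 < e -> exists n, [set y | agree iota n x y] `<=` ball x e.
Proof.
move=> /half_cvg[n ne]; exists n => y /cube_dist_le xy.
by rewrite ballE /=; exact: le_lt_trans ne.
Qed.

Let open_agree (O : set M) x : open O -> O x ->
  exists n, [set y | agree iota n x y] `<=` O.
Proof.
rewrite openE => Oo Ox; have /nbhs_ballP[e /= e0 eO] := Oo _ Ox.
have [n nO] := agree_ball x e0; exists n; exact: subset_trans eO.
Qed.

Lemma cube_metric_complete : complete_metric M.
Proof.
move=> F PF /cauchyP Fc.
have Fn n : exists x, F (ball (x : M) (2^-1 ^+ n)) by apply: Fc; exact: exprn_gt0.
have [f Hf] := choice Fn.
(* [agree n] controls the coordinates numbered below n, so coordinate [i] is settled at level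
   [(iota i).+1]. *)
pose l : M := fun i => f (iota i).+1 i.
exists l; apply/fcvg_ballP => e e0; have [n nO] := agree_ball l e0.
apply: filterS (Hf n) => y /ball_agree fy; apply: nO => i im.
have [z [/ball_agree z1 /ball_agree z2]] := filter_ex (filterI (Hf (iota i).+1) (Hf n)).
by rewrite /l z1 // -z2 // fy.
Qed.

Definition finite_point (l : seq nat) : M := fun i => iota i \in l.

Lemma finite_point_dense (x : M) n : exists l, agree iota n x (finite_point l).
Proof.
exists [seq k <- seq.iota 0 n | `[< exists i, iota i = k /\ x i >]] => i im.
rewrite /finite_point mem_filter mem_iota add0n leq0n im andbT.
case: asboolP => [[j [/iota_inj <- //]]|H].
by apply/negP => xi; apply: H; exists i.
Qed.

Lemma cube_metric_separable : separable M.
Proof.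
exists (range finite_point).
  by apply: (@sub_countable _ _ _ [set: seq nat]) => //; exact: card_image_le.
move=> O [x Ox] Oo; have [n nO] := open_agree Oo Ox.
have [l xl] := finite_point_dense x n.
by exists (finite_point l); split; [exact: nO|exists l].
Qed.

Lemma measurable_agree n (x : cube I) : measurable [set y : cube I | agree iota n x y].
Proof.
rewrite (_ : [set _ | _] = \bigcap_(k in [set k | (k < n)%N])
    [set y : cube I | forall i, iota i = k -> x i = y i]); last first.
  apply/seteqP; split => y Hy => [k /= kn i ik|i im]; last exact: Hy im _ erefl.
  by apply: Hy; rewrite ik.
apply: bigcap_measurableType => k _.
have [[i ik]|nk] := pselect (exists i, iota i = k); last first.
  rewrite (_ : [set _ | _] = setT); first exact: measurableT.
  by apply/seteqP; split => // y _ i ik; exfalso; apply: nk; exists i.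
rewrite (_ : [set _ | _] = [set y : cube I | x i = y i]); last first.
  by apply/seteqP; split => y Hy; [exact: Hy|move=> j; rewrite -ik => /iota_inj ->].
case xi : (x i).
  rewrite (_ : [set _ | _] = [set y : cube I | y i]); first exact: measurable_coord.
  by apply/seteqP; split => y /=; [move=> <-|move=> ->].
rewrite (_ : [set _ | _] = ~` [set y : cube I | y i]).
  by apply: measurableC; exact: measurable_coord.
by apply/seteqP; split => y /=; [move=> <-|case: (y i)].
Qed.

(** Coordinate sets are open. Conversely, an open set is a union of sets given by [agree] around
    points of finite support; there are only countably many of these, all measurable. *)
Lemma cube_standard_borel : standard_borel R (cube I).
Proof.
exists M, (fun x => x); split.
- exact: cube_metric_complete.
- exact: cube_metric_separable.
- by exists (fun x => x).
move=> B; split; last first.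
  apply: smallest_sub; first exact: smallest_sigma_algebra.
  move=> _ [i ->]; apply: sub_sigma_algebra; rewrite openE => x xi.
  apply/nbhs_ballP; exists (2^-1 ^+ (iota i).+1); first exact: exprn_gt0.
  by move=> y /ball_agree xy /=; rewrite -xy.
rewrite preimage_id; apply: smallest_sub; first exact: smallest_sigma_algebra.
move=> O Oo.
pose D := [set p : seq nat * nat | [set y | agree iota p.2 (finite_point p.1) y] `<=` O].
rewrite (_ : O = \bigcup_(p in D) [set y : cube I | agree iota p.2 (finite_point p.1) y]).
  (* The pairs in [D] are enumerated by their codes; every other code contributes the empty set. *)
  rewrite (_ : \bigcup_(p in D) _ = \bigcup_n
      (if choice.unpickle n is Some p then
         if `[< D p >] then [set y : cube I | agree iota p.2 (finite_point p.1) y] else set0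
       else set0)).
    apply: bigcupT_measurable => n; case: (choice.unpickle n) => [p|//].
    by case: ifP => // _; exact: measurable_agree.
  apply/seteqP; split => y [].
    by move=> p Dp yp; exists (choice.pickle p) => //; rewrite choice.pickleK; case: asboolP.
  by move=> n _; case: (choice.unpickle n) => // p; case: asboolP => // Dp yp; exists p.
apply/seteqP; split => [x Ox|x [p Dp]]; last exact: Dp.
have [n nO] := open_agree Oo Ox; have [l xl] := finite_point_dense x n.
exists (l, n) => /=; last by move=> i im; rewrite xl.
by move=> y ly; apply: nO => i im; rewrite xl // ly.
Qed.

End cube_standard.

(** * Sets depending on finitely many coordinates *)

Section symdiff.
Context (T : Type).
Implicit Types A B C D : set T.

Definition symdiff A B := (A `\` B) `|` (B `\` A).

Lemma symdiff_sub3 A B C : symdiff A C `<=` symdiff A B `|` symdiff B C.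
Proof.
move=> x; rewrite /symdiff => -[[a c]|[c a]]; have [b|b] := pselect (B x).
- by right; left.
- by left; left.
- by left; right.
- by right; right.
Qed.

Lemma symdiff_setC A B : symdiff (~` A) (~` B) = symdiff A B.
Proof. by rewrite /symdiff !setDE !setCK setIC [~` B `&` _]setIC setUC. Qed.

Lemma symdiff_setU A B C D :
  symdiff (A `|` B) (C `|` D) `<=` symdiff A C `|` symdiff B D.
Proof.
move=> x; rewrite /symdiff => -[[[a|b] /not_orP[c e]]|[[c|e] /not_orP[a b]]].
- by left; left.
- by right; left.
- by left; right.
- by right; right.
Qed.

Lemma symdiff_setI A B C D :
  symdiff (A `&` B) (C `&` D) `<=` symdiff A C `|` symdiff B D.
Proof.
move=> x; rewrite /symdiff => -[[[a b] /not_andP[c|e]]|[[c e] /not_andP[a|b]]].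
- by left; left.
- by right; left.
- by left; right.
- by right; right.
Qed.

End symdiff.

Section real_probability.
Context (R : realType) d (T : measurableType d) (P : probability T R).
Implicit Types A B : set T.

Definition pr A : R := fine (P A).

Lemma prE A : measurable A -> P A = (pr A)%:E.
Proof. by move=> mA; rewrite fineK // fin_num_measure. Qed.

Lemma le_pr A B : measurable A -> measurable B -> A `<=` B -> pr A <= pr B.
Proof.
by move=> mA mB AB; rewrite -lee_fin -!prE //; apply: le_measure; rewrite ?inE.
Qed.

Lemma pr_setU A B : measurable A -> measurable B -> A `&` B = set0 ->
  pr (A `|` B) = pr A + pr B.
Proof.
move=> mA mB AB; apply: EFin_inj; rewrite EFinD -!prE //; last exact: measurableU.
exact: measureU.
Qed.

Lemma pr_setD A B : measurable A -> measurable B -> B `<=` A ->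
  pr (A `\` B) = pr A - pr B.
Proof.
move=> mA mB BA; apply/esym/eqP; rewrite subr_eq; apply/eqP.
rewrite -pr_setU ?setDKU //; first exact: measurableD.
by rewrite setDE -setIA setICl setI0.
Qed.

Lemma pr_setU_le A B : measurable A -> measurable B -> pr (A `|` B) <= pr A + pr B.
Proof.
move=> mA mB; rewrite -lee_fin EFinD -!prE //; last exact: measurableU.
exact: measureU2.
Qed.

Lemma measurable_symdiff A B : measurable A -> measurable B -> measurable (symdiff A B).
Proof. by move=> mA mB; apply: measurableU; exact: measurableD. Qed.

Lemma pr_symdiff A B : measurable A -> measurable B ->
  `|pr A - pr B| <= pr (symdiff A B).
Proof.
move=> mA mB.
have H C D : measurable C -> measurable D -> pr C <= pr D + pr (symdiff C D).
  move=> mC mD; apply: (@le_trans _ _ (pr (D `|` symdiff C D))).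
    apply: le_pr => //; first by apply: measurableU => //; exact: measurable_symdiff.
    by move=> x Cx; have [Dx|nDx] := pselect (D x); [left|right; left].
  by apply: pr_setU_le => //; exact: measurable_symdiff.
have h1 := H _ _ mA mB; have := H _ _ mB mA.
rewrite [symdiff B A]setUC => h2; rewrite ler_norml; apply/andP; split; lra.
Qed.

Lemma pr_bigcup_cvg (B : nat -> set T) : (forall n, measurable (B n)) ->
  {homo B : m n / (m <= n)%N >-> m `<=` n} ->
  forall e : R, 0 < e -> exists n, pr (symdiff (\bigcup_n B n) (B n)) < e.
Proof.
move=> mB ndB e e0.
have mU : measurable (\bigcup_n B n) by exact: bigcupT_measurable.
have nd : nondecreasing_seq B by move=> m n mn; apply/subsetPset; exact: ndB.
have : P (B n) @[n --> \oo] --> (pr (\bigcup_n B n))%:E.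
  by rewrite -(prE mU); exact: nondecreasing_cvg_mu.
move => /fine_cvgP[_ /cvgrPdist_lt/(_ _ e0)[n _ /(_ n (leqnn n))]] /= h.
exists n.
rewrite /symdiff (_ : B n `\` _ = set0) ?setU0; last first.
  by apply/seteqP; split => // x [Bx]; apply; exists n.
rewrite pr_setD //; last by move=> x Bx; exists n.
by apply: le_lt_trans h; exact: ler_norm.
Qed.

End real_probability.

Section finite_dependence.
Context (I : eqType).
Implicit Types (s t u : seq I) (C : set (cube I)).

Definition depends_on u C :=
  forall x y : cube I, {in u, x =1 y} -> C x -> C y.

Lemma depends_onC u C : depends_on u C -> depends_on u (~` C).
Proof. by move=> uC x y xy nCx Cy; apply/nCx/uC/Cy => i iu; rewrite xy. Qed.

Lemma depends_onU u v C D : depends_on u C -> depends_on v D ->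
  depends_on (u ++ v) (C `|` D).
Proof.
move=> uC vD x y xy [Cx|Dx]; [left|right].
  by apply: uC Cx => i iu; apply: xy; rewrite mem_cat iu.
by apply: vD Dx => i iu; apply: xy; rewrite mem_cat iu orbT.
Qed.

Lemma depends_onI u v C D : depends_on u C -> depends_on v D ->
  depends_on (u ++ v) (C `&` D).
Proof.
by move=> uC vD; rewrite -[_ `&` _]setCK setCI; apply/depends_onC/depends_onU; exact: depends_onC.
Qed.

Definition atom s t : set (cube I) := cyl s `&` [set x | forall i, i \in t -> ~~ x i].

Lemma atom_nil s : atom s [::] = cyl s.
Proof. by apply/seteqP; split => [x []//|x sx]; split. Qed.

Lemma atom_consr s i t : atom s (i :: t) = atom s t `\` atom (i :: s) t.
Proof.
apply/seteqP; split => [x [sx itx]|x [[sx tx] nx]].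
  have ix : ~~ x i by apply: itx; rewrite inE eqxx.
  split; first by split => // j jt; apply: itx; rewrite inE jt orbT.
  by move=> [/(_ i)]; rewrite inE eqxx => /(_ isT); rewrite (negbTE ix).
split => // j; rewrite inE => /predU1P[->|]; last exact: tx.
apply/negP => xi; apply: nx; split => // k.
by rewrite inE => /predU1P[->//|]; exact: sx.
Qed.

Lemma atom_consl s i t : atom (i :: s) t `<=` atom s t.
Proof. by move=> x [sx tx]; split => // j js; apply: sx; rewrite inE js orbT. Qed.

(* Splitting a set according to the value of one coordinate reduces any property of
   sets that is stable under differences and disjoint unions to cylinders. *)
Lemma depends_on_ind (Q : set (set (cube I))) : Q set0 ->
  (forall s, Q (cyl s)) ->
  (forall A B, Q A -> Q B -> B `<=` A -> Q (A `\` B)) ->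
  (forall A B, Q A -> Q B -> A `&` B = set0 -> Q (A `|` B)) ->
  forall u C, depends_on u C -> Q C.
Proof.
move=> Q0 Qcyl QD QU.
have Qatom s t : Q (atom s t).
  elim: t s => [|i t IH] s; first by rewrite atom_nil.
  by rewrite atom_consr; apply: QD => //; exact: atom_consl.
(* The atom records the coordinates already split, so that the list [u] can shrink. *)
suff H u C s t : depends_on u C -> Q (C `&` atom s t).
  move=> u C /(H _ _ [::] [::]); rewrite atom_nil cyl_nil setIT; exact.
elim: u C s t => [|i u IH] C s t uC.
  have [->|/set0P[x Cx]] := eqVneq C set0; first by rewrite set0I.
  rewrite (_ : C = setT) ?setTI //; apply/seteqP; split => // y _.
  exact: uC Cx.
(* Overwriting coordinate [i] by [b] yields a set that depends on [u] alone and coincides with [C]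
   wherever x i = b. *)
pose upd b (x : cube I) : cube I := fun j => if j == i then b else x j.
have updK b x : x i = b -> upd b x = x.
  by move=> xi; apply/funext => j; rewrite /upd; case: eqP => // ->.
have updC b : depends_on u (upd b @^-1` C).
  move=> x y xy; apply: uC => j; rewrite inE /upd.
  by case: eqP => // _ /= /xy.
rewrite (_ : _ `&` _ = (upd true @^-1` C `&` atom (i :: s) t) `|`
    (upd false @^-1` C `&` atom s (i :: t))).
  apply: QU; [exact: IH|exact: IH|].
  apply/seteqP; split => // x [[_ [sx _]] [_ [_ tx]]].
  have := tx i; rewrite inE eqxx => /(_ isT).
  by rewrite (sx i) // inE eqxx.
apply/seteqP; split => x.
  move=> [Cx [sx tx]]; case xi : (x i); [left|right]; split.
  - by rewrite /preimage /= updK.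
  - by split => // j; rewrite inE => /predU1P[->//|]; exact: sx.
  - by rewrite /preimage /= updK.
  - by split => // j; rewrite inE => /predU1P[->|]; [rewrite xi|exact: tx].
move=> [[Cx [sx tx]]|[Cx [sx tx]]].
  split; last by split => // j js; apply: sx; rewrite inE js orbT.
  by move: Cx; rewrite /preimage /= updK //; apply: sx; rewrite inE eqxx.
split; last by split => // j js; apply: tx; rewrite inE js orbT.
move: Cx; rewrite /preimage /= updK //; apply/negbTE; apply: tx; rewrite inE eqxx //.
Qed.

Lemma depends_on_measurable u C : depends_on u C -> measurable C.
Proof.
apply: depends_on_ind => //.
- exact: measurable_cyl.
- by move=> A B mA mB _; exact: measurableD.
- by move=> A B mA mB _; exact: measurableU.
Qed.

(** Convergence passes to differences of nested sets and to disjoint unions, so [depends_on_ind]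
    reduces it to cylinders; measurability is carried along in the induction. *)
Lemma depends_on_cvg (R : realType) (P_ : nat -> probability (cube I) R)
    (P : probability (cube I) R) :
  (forall s, pr (P_ n) (cyl s) @[n --> \oo] --> pr P (cyl s)) ->
  forall u C, depends_on u C -> pr (P_ n) C @[n --> \oo] --> pr P C.
Proof.
move=> Hcyl u C uC.
suff [] : measurable C /\ pr (P_ n) C @[n --> \oo] --> pr P C by [].
move: u C uC; apply: depends_on_ind.
- split => //; rewrite /pr measure0.
  by under eq_fun do rewrite measure0; exact: cvg_cst.
- by move=> s; split; [exact: measurable_cyl|exact: Hcyl].
- move=> A B [mA cA] [mB cB] BA; split; first exact: measurableD.
  rewrite pr_setD //; under eq_fun do rewrite pr_setD //.
  exact: cvgB.
- move=> A B [mA cA] [mB cB] AB; split; first exact: measurableU.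
  rewrite pr_setU //; under eq_fun do rewrite pr_setU //.
  exact: cvgD.
Qed.

(** The measurable sets that can be approximated within every error form a sigma-algebra containing
    the coordinate sets. *)
Lemma depends_on_approx (R : realType) (P : probability (cube I) R) (A : set (cube I))
    (e : R) : measurable A -> 0 < e ->
  exists u C, depends_on u C /\ pr P (symdiff A C) < e.
Proof.
move=> mA e0; pose S := [set A : set (cube I) | measurable A /\ forall e : R, 0 < e ->
  exists u C, depends_on u C /\ pr P (symdiff A C) < e].
suff : S A by move=> [_ /(_ _ e0)].
have S0 B u : depends_on u B -> S B.
  move=> uB; split=> [|e' e'0]; first exact: depends_on_measurable uB.
  by exists u, B; split => //; rewrite /symdiff setDv setU0 /pr measure0.
have SU B C : S B -> S C -> S (B `|` C).
  move=> [mB HB] [mC HC]; split; first exact: measurableU.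
  move=> e' e'0; have e2 : 0 < e' / 2 by rewrite divr_gt0.
  have [u [D [uD BD]]] := HB _ e2; have [v [E [vE CE]]] := HC _ e2.
  exists (u ++ v), (D `|` E); split; first exact: depends_onU.
  have mD := depends_on_measurable uD; have mE := depends_on_measurable vE.
  apply: (@le_lt_trans _ _ (pr P (symdiff B D `|` symdiff C E))).
    apply: le_pr; last exact: symdiff_setU.
      by apply: measurable_symdiff; exact: measurableU.
    by apply: measurableU; exact: measurable_symdiff.
  apply: (le_lt_trans (pr_setU_le _ _ _)); [exact: measurable_symdiff..|].
  by rewrite (splitr e') ltrD.
have SC B : S B -> S (~` B).
  move=> [mB HB]; split; first exact: measurableC.
  move=> e' /HB[u [D [uD BD]]]; exists u, (~` D); split; first exact: depends_onC.
  by rewrite symdiff_setC.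
suff sub : <<s @cube_sets I >> `<=` S by exact: sub.
apply: smallest_sub; last first.
  move=> _ [i ->]; apply: (S0 _ [:: i]) => x y xy /=.
  by rewrite -xy // inE.
split.
- by apply: (S0 _ [::]).
- by move=> B SB; rewrite setTD; exact: SC.
- move=> F SF.
  (* By continuity from below some finite partial union is within e'/2 of the whole union, and it
     can be approximated within e'/2 in turn. *)
  pose B n := \bigcup_(i in [set i | (i < n)%N]) F i.
  have SB n : S (B n).
    elim: n => [|n IH].
      by rewrite /B (_ : [set _ | _] = set0) ?bigcup_set0; [exact: (S0 _ [::])|apply/seteqP; split].
    rewrite (_ : B n.+1 = B n `|` F n); first exact: SU.
    apply/seteqP; split => x.
      move=> [i /=]; rewrite ltnS leq_eqVlt => /predU1P[->|im] Fx; first by right.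
      by left; exists i.
    by move=> [[i /= im] Fx|Fx]; [exists i => //=; exact: ltnW|exists n => /=].
  have FB : \bigcup_k F k = \bigcup_n B n.
    apply/seteqP; split => x; first by move=> [k _ Fx]; exists k.+1 => //; exists k => /=.
    by move=> [n _ [k _ Fx]]; exists k.
  rewrite FB; split; first by apply: bigcupT_measurable => n; exact: (SB n).1.
  move=> e' e'0; have e2 : 0 < e' / 2 by rewrite divr_gt0.
  have [|m n mn|n Hn] := @pr_bigcup_cvg R _ _ P B _ _ _ e2.
  + by move=> n; exact: (SB n).1.
  + by move=> x [i /= im Fx]; exists i => //=; exact: leq_trans mn.
  have [u [D [uD BD]]] := (SB n).2 _ e2.
  exists u, D; split => //.
  have mD := depends_on_measurable uD; have mB := (SB n).1.
  pose U : set (cube I) := \bigcup_n B n; rewrite -/U in Hn *.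
  have mU : measurable U by apply: bigcupT_measurable => k; exact: (SB k).1.
  apply: (@le_lt_trans _ _ (pr P (symdiff U (B n) `|` symdiff (B n) D))).
    apply: le_pr; [exact: measurable_symdiff| |exact: symdiff_sub3].
    by apply: measurableU; exact: measurable_symdiff.
  apply: (le_lt_trans (pr_setU_le _ _ _)); [exact: measurable_symdiff..|].
  by rewrite (splitr e') ltrD.
Qed.

End finite_dependence.

(** * Factors of the Bernoulli shift *)

Section factors.
Context (R : realType) (G : groupType).
Context (lam : probability (shift_space R G) R) (Hlam : product_lebesgue lam).

Lemma unit_lebesgue_le (c : R) : 0 <= c <= 1 ->
  unit_lebesgue [set t : unit_itv R | sval t <= c] = c%:E.
Proof.
move=> /andP[c0 c1]; rewrite /unit_lebesgue.
rewrite (_ : [set sval x | x in _] = `[0, c]%classic).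
  by rewrite lebesgue_measure_itv /= lte_fin; case: ltP => [_|c0']; [rewrite oppr0 adde0|
    congr (_%:E); apply/eqP; rewrite eq_le c0 c0'].
apply/seteqP; split => [_ [[x /= /andP[x0 x1]] /= xc <-]|x /=]; rewrite in_itv /=.
  by rewrite x0.
move=> /andP[x0 xc]; have x01 : 0 <= x <= 1 by rewrite x0 (le_trans xc).
by exists (exist _ x x01).
Qed.

Lemma measurable_coord_le (c : R) (g : G) :
  measurable [set f : shift_space R G | sval (f g) <= c].
Proof.
apply: sub_sigma_algebra; exists g, [set t | sval t <= c]; split => //.
exists `]-oo, c]%classic; first exact: measurable_itv.
by apply/seteqP; split => t /=; rewrite in_itv.
Qed.

Lemma lam_le (c : R) (U : {fset G}) : 0 <= c <= 1 ->
  lam [set f | forall u, u \in U -> sval (f u) <= c] = (c ^+ #|` U|)%:E.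
Proof.
move=> c01.
have := Hlam (s := U) (B := fun=> [set t : unit_itv R | sval t <= c]) (fset_uniq U).
rewrite /= => -> //; last first.
  move=> g; exists `]-oo, c]%classic; first exact: measurable_itv.
  by apply/seteqP; split => t /=; rewrite in_itv.
rewrite unit_lebesgue_le // big_const_seq count_predT.
elim: (size U) => [|n IH] /=; first by rewrite expr0.
by rewrite IH -EFinM exprS.
Qed.

Definition cube_shift (g : G) (x : cube G) : cube G := fun h => x (g^-1 * h)%g.

Lemma measurable_cube_shift g : measurable_fun setT (cube_shift g).
Proof. by apply: cube_measurable_fun => h; exact: measurable_coord. Qed.

Lemma cube_shift1 x : cube_shift 1%g x = x.
Proof. by apply/funext => h; rewrite /cube_shift invg1 mul1g. Qed.

Lemma cube_shiftM g h x : cube_shift (g * h)%g x = cube_shift g (cube_shift h x).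
Proof. by apply/funext => k; rewrite /cube_shift invgM mulgA. Qed.

Lemma image_cube_shift g A : cube_shift g @` A = cube_shift g^-1%g @^-1` A.
Proof.
apply/seteqP; split => [_ [x Ax <-]|x Ax] /=.
  by rewrite -cube_shiftM mulVg cube_shift1.
by exists (cube_shift g^-1%g x) => //; rewrite -cube_shiftM mulgV cube_shift1.
Qed.

Lemma image_shift (g : G) (A : set (shift_space R G)) :
  Defs.shift g @` A = Defs.shift g^-1%g @^-1` A.
Proof.
have sM h k (f : shift_space R G) : Defs.shift (h * k)%g f = Defs.shift h (Defs.shift k f).
  by apply/funext => u; rewrite /Defs.shift invgM mulgA.
have s1 (f : shift_space R G) : Defs.shift 1%g f = f.
  by apply/funext => u; rewrite /Defs.shift invg1 mul1g.
apply/seteqP; split => [_ [x Ax <-]|x Ax] /=.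
  by rewrite -sM mulVg s1.
by exists (Defs.shift g^-1%g x) => //; rewrite -sM mulgV s1.
Qed.

Section finite_factors.
Context (K : {fset G}) (c : R).

(** [K] multiplies on the right and the shift acts on the left, whence the exact equivariance. *)
Definition finite_factor (f : shift_space R G) : cube G :=
  fun g => all (fun n => sval (f (g * n)%g) <= c) K.

Lemma finite_factor_shift h f : finite_factor (Defs.shift h f) = cube_shift h (finite_factor f).
Proof.
by apply/funext => g; apply: eq_all => n; rewrite /Defs.shift mulgA.
Qed.

Lemma measurable_finite_factor : measurable_fun setT finite_factor.
Proof.
apply: cube_measurable_fun => g; rewrite /finite_factor.
elim: (enum_fset K) => [|n s IH] /=.
  by rewrite (_ : [set _ | _] = setT) //; apply/seteqP; split.
rewrite (_ : [set _ | _] = [set f : shift_space R G | sval (f (g * n)%g) <= c] `&`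
  [set f : shift_space R G | all (fun n => sval (f (g * n)%g) <= c) s]).
  by apply: measurableI => //; exact: measurable_coord_le.
by apply/seteqP; split => f /= => [/andP[]|[-> ->]].
Qed.

Definition factor_law : probability (cube G) R := push_probability measurable_finite_factor lam.

(** The image is 1 on [s] exactly when f <= c on the product set sK, that is, at |sK| independent
    coordinates. *)
Lemma factor_law_cyl s : 0 <= c <= 1 ->
  factor_law (cyl s) = (c ^+ #|` mulfs [fset g in s]%fset K|)%:E.
Proof.
move=> c01; rewrite -lam_le // push_probabilityE; congr (lam _).
apply/seteqP; split => f Hf.
  move=> u /mulfsP[g]; rewrite inE => gs gu.
  by have /allP/(_ _ gu) := Hf g gs; rewrite mulVKg.
move=> g gs; apply/allP => n nK; apply: Hf.
by apply/mulfsP; exists g; rewrite ?inE ?mulKg.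
Qed.

End finite_factors.

(** * The factor indexed by the cosets of N *)

Section quotient_factor.
Context (N : set G) (sN : subgroup N).

(** The choice made by [xget] depends only on the coset gN as a set, so elements of one coset share
    their representative. *)
Definition coset_rep (g : G) : G := xget 1%g [set u | N (g^-1 * u)%g].

Lemma coset_repP g : N (g^-1 * coset_rep g)%g.
Proof.
rewrite /coset_rep; case: xgetP => [x -> //|/(_ g)]; case.
by rewrite /= mulVg; exact: (subgroup1 sN).
Qed.

Lemma coset_rep_eq g h : N (g^-1 * h)%g -> coset_rep g = coset_rep h.
Proof.
move=> Ngh; rewrite /coset_rep; congr (xget _ _); apply/seteqP; split => u /= Nu.
  rewrite (_ : h^-1 * u = (g^-1 * h)^-1 * (g^-1 * u))%g.
    by apply: (subgroupM sN) => //; exact: (subgroupV sN).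
  by rewrite invgM invgK -mulgA mulVKg.
rewrite (_ : g^-1 * u = (g^-1 * h) * (h^-1 * u))%g; first exact: (subgroupM sN).
by rewrite -mulgA mulVKg.
Qed.

Lemma coset_rep_id g : coset_rep (coset_rep g) = coset_rep g.
Proof. by apply/esym/coset_rep_eq/coset_repP. Qed.

Lemma coset_rep_mul h g : coset_rep (h * coset_rep g)%g = coset_rep (h * g)%g.
Proof.
apply/esym/coset_rep_eq; rewrite invgM -mulgA mulKg; exact: coset_repP.
Qed.

Definition reps (s : seq G) : {fset G} := [fset coset_rep g | g in s]%fset.

Let c0 : R := expR (-1).

Let c01 : 0 <= c0 <= 1.
Proof. by rewrite /c0 expR_ge0 /= -[leRHS]expR0 ler_expR oppr_le0. Qed.

(* The space {0,1}^(G/N) is encoded as the set of points of {0,1}^G that are constant on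
   the cosets gN, so that no quotient type is needed. *)
Definition quotient_factor (f : shift_space R G) : cube G :=
  fun g => sval (f (coset_rep g)) <= c0.

Lemma measurable_quotient_factor : measurable_fun setT quotient_factor.
Proof. by apply: cube_measurable_fun => g; exact: measurable_coord_le. Qed.

Definition quotient_law : probability (cube G) R :=
  push_probability measurable_quotient_factor lam.

Lemma quotient_law_cyl s : quotient_law (cyl s) = (expR (- (#|` reps s|)%:R))%:E.
Proof.
transitivity (c0 ^+ #|` reps s|)%:E; last first.
  by congr (_%:E); rewrite /c0 -expRM_natl mulrN1.
rewrite -lam_le // push_probabilityE; congr (lam _).
apply/seteqP; split => f Hf.
  by move=> _ /imfsetP[g /= gs ->]; exact: Hf.
by move=> g gs; apply: Hf; apply/imfsetP; exists g.
Qed.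

Lemma card_reps_mul h s : #|` reps [seq (h * g)%g | g <- s]| = #|` reps s|.
Proof.
(* Left multiplication induces a map on cosets, so their number cannot grow; using this for [h] and
   for its inverse gives equality. *)
have H k t : (#|` reps [seq (k * g)%g | g <- t]| <= #|` reps t|)%N.
  have -> : reps [seq (k * g)%g | g <- t] = [fset coset_rep (k * q)%g | q in reps t]%fset.
    apply/fsetP => x; apply/imfsetP/imfsetP => /= -[].
      move=> _ /mapP[g gt ->] ->; exists (coset_rep g).
        by apply/imfsetP; exists g.
      by rewrite coset_rep_mul.
    move=> _ /imfsetP[g /= gt ->] ->; exists (k * g)%g; first exact: map_f.
    by rewrite coset_rep_mul.
  exact: leq_imfset_card.
apply/eqP; rewrite eqn_leq H /=.
have := H (h^-1)%g [seq (h * g)%g | g <- s].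
rewrite -map_comp (eq_map (_ : _ =1 id)) ?map_id // => g /=.
by rewrite mulKg.
Qed.

(** The preimage of a cylinder is the cylinder over a translated list, which meets equally many
    cosets by [card_reps_mul]. *)
Lemma quotient_law_invariant g A : measurable A ->
  quotient_law (cube_shift g @^-1` A) = quotient_law A.
Proof.
move=> mA; have := @cube_measure_unique R G (push (measurable_cube_shift g) quotient_law)
  quotient_law _ _ A mA; apply.
  by rewrite pushE preimage_setT -[X in (X < _)%E]/(quotient_law setT) probability_setT ltry.
move=> s.
have e : quotient_law (cyl [seq (g^-1 * h)%g | h <- s]) = quotient_law (cyl s).
  by rewrite !quotient_law_cyl card_reps_mul.
apply: etrans e; rewrite pushE; congr (quotient_law _); apply/seteqP; split => x Hx h.
  by move=> /mapP[k ks ->]; exact: Hx.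
by move=> hs; apply: Hx; exact: map_f.
Qed.

Lemma quotient_mp_action (iota : G -> nat) : injective iota ->
  mp_action quotient_law cube_shift.
Proof.
move=> iota_inj; split.
- exact: cube_standard_borel iota_inj.
- exact: cube_shift1.
- by move=> g h x; exact: cube_shiftM.
- exact: measurable_cube_shift.
- by move=> g A mA; rewrite image_cube_shift quotient_law_invariant.
Qed.

(** One coordinate is 1 with probability 1/e, whereas a point mass takes only the values 0 and 1. *)
Lemma quotient_not_point_mass : ~ point_mass quotient_law.
Proof.
move=> [x Hx]; have := Hx _ (measurable_cyl [:: 1%g]).
rewrite quotient_law_cyl (_ : reps [:: 1%g] = [fset coset_rep 1%g]%fset); last first.
  apply/fsetP => q; rewrite inE; apply/imfsetP/eqP => /= [[g]|->].
    by rewrite inE => /eqP -> ->.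
  by exists 1%g; rewrite ?inE.
rewrite cardfs1 diracE => -[]; have := expR_gt0 (- 1%:R : R).
have : expR (- 1%:R : R) < 1 by rewrite -[ltRHS]expR0 ltr_expR oppr_lt0.
by case: (_ \in _) => /= + + e; rewrite e ltxx.
Qed.

Lemma quotient_not_free g : (forall g x : G, N x -> N (x ^ g)%g) -> N g -> g <> 1%g ->
  ~ free_action quotient_law cube_shift.
Proof.
move=> nN Ng g1 /(_ g g1); rewrite push_probabilityE.
rewrite (_ : _ @^-1` _ = setT).
  by rewrite probability_setT => -[e]; have := oner_neq0 R; rewrite e eqxx.
apply/seteqP; split => // f _; apply/funext => h /=.
(* Normality enters here: g^-1 h and h lie in the same coset because h^-1 g h is in [N]. *)
rewrite /cube_shift /quotient_factor (@coset_rep_eq (g^-1 * h)%g h) //.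
by rewrite invgM invgK -mulgA -/(conjg _ _); exact: nN.
Qed.

End quotient_factor.
End factors.

(** * Weak containment *)

Section translates.
Context (G : groupType).
Implicit Types K : {fset G}.
Local Open Scope fset_scope.

Lemma card_bigfcup_le (I : eqType) (s : seq I) (F : I -> {fset G}) :
  (#|` \bigcup_(i <- s) F i| <= \sum_(i <- s) #|` F i|)%N.
Proof.
elim: s => [|i s IH]; first by rewrite !big_nil cardfs0.
rewrite !big_cons cardfsU; apply: leq_trans (leq_subr _ _) _.
by rewrite leq_add2l.
Qed.

Lemma card_lmulfsD a b K :
  #|` lmulfs a K `\` lmulfs b K| = #|` lmulfs (b^-1 * a)%g K `\` K|.
Proof.
rewrite -(card_lmulfs b (lmulfs (b^-1 * a)%g K `\` K)); congr #|` _|.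
apply/fsetP => x; rewrite mem_lmulfs !in_fsetD !mem_lmulfs.
by rewrite invgM invgK -mulgA mulVKg.
Qed.

(** A point of the first union that is missing from the second lies in some difference of the
    translates by [a g] and [b g], and [card_lmulfsD] translates that difference back to [K]. *)
Lemma card_union_translates (a b : G -> G) (s : seq G) K :
  (#|` \bigcup_(g <- s) lmulfs (a g) K| <=
   #|` \bigcup_(g <- s) lmulfs (b g) K| +
   \sum_(g <- s) #|` lmulfs ((b g)^-1 * a g)%g K `\` K|)%N.
Proof.
set B := \bigcup_(g <- s) lmulfs (b g) K.
have sub : \bigcup_(g <- s) lmulfs (a g) K `<=`
    B `|` \bigcup_(g <- s) (lmulfs (a g) K `\` lmulfs (b g) K).
  apply/fsubsetP => x /bigfcupP[g /andP[gs _] xg]; rewrite in_fsetU.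
  have [xb|xb] := boolP (x \in lmulfs (b g) K); apply/orP; [left|right].
    by apply/bigfcupP; exists g; rewrite ?gs.
  by apply/bigfcupP; exists g; rewrite ?gs // in_fsetD xb.
apply: (leq_trans (fsubset_leq_card sub)).
rewrite cardfsU; apply: leq_trans (leq_subr _ _) _; rewrite leq_add2l.
apply: (leq_trans (card_bigfcup_le _ _)).
by under eq_bigr do rewrite card_lmulfsD.
Qed.

Lemma mulfs_bigfcup s K : mulfs [fset g in s] K = \bigcup_(g <- s) lmulfs g K.
Proof.
apply/fsetP => x; apply/mulfsP/bigfcupP => [[g]|[g /andP[gs _]]].
  by rewrite inE => gs gx; exists g; rewrite ?gs // mem_lmulfs.
by rewrite mem_lmulfs => gx; exists g; rewrite ?inE.
Qed.

Section cosets.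
Context (N : set G) (sN : subgroup N).

Lemma mulfs_reps_bigfcup s K :
  mulfs (reps N s) K = \bigcup_(g <- s) lmulfs (coset_rep N g) K.
Proof.
apply/fsetP => x; apply/mulfsP/bigfcupP => [[_ /imfsetP[g /= gs ->] gx]|[g /andP[gs _]]].
  by exists g; rewrite ?gs // mem_lmulfs.
by rewrite mem_lmulfs => gx; exists (coset_rep N g) => //; apply/imfsetP; exists g.
Qed.

(** Distinct representatives lie in distinct cosets and [K] lies in [N], so the products are
    pairwise distinct. *)
Lemma card_mulfs_reps s K : {in K, forall x, N x} ->
  #|` mulfs (reps N s) K| = (#|` reps N s| * #|` K|)%N.
Proof.
move=> KN; rewrite -(size_allpairs (fun x y : G => (x * y)%g)); apply: perm_size.
apply: uniq_perm; first exact: fset_uniq.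
  apply: allpairs_uniq; [exact: fset_uniq..|].
  move=> [q x] [q' x'] /allpairsP[[q1 x1] [/= /imfsetP[g /= _ eq1] xK [-> ->]]].
  move=> /allpairsP[[q2 x2] [/= /imfsetP[h /= _ eq2] x'K [-> ->]]] e.
  have eq : q1 = q2.
    rewrite eq1 eq2 -(coset_rep_id sN g) -(coset_rep_id sN h) -eq1 -eq2.
    apply: (coset_rep_eq sN).
    rewrite (_ : q1^-1 * q2 = x1 * x2^-1)%g.
      by apply: (subgroupM sN); [exact: KN|apply: (subgroupV sN); exact: KN].
    by rewrite -(mulgK x2 q2) -e !mulgA mulVg mul1g.
  by move: e; rewrite eq => /mulgI ->.
move=> z; apply/mulfsP/allpairsP => [[q qR qz]|[[q x] [/= qR xK ->]]].
  by exists (q, (q^-1 * z)%g) => /=; split => //; rewrite mulVKg.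
by exists q => //; rewrite mulKg.
Qed.

End cosets.
End translates.

(** * Convergence of the finite factors along a Folner sequence *)

Section weak_limit.
Context (R : realType) (G : groupType) (N : set G).
Context (sN : subgroup N) (aN : amenable R N).
Context (iota : G -> nat) (iota_inj : injective iota).
Context (lam : probability (shift_space R G) R) (Hlam : product_lebesgue lam).

(** A diagonal choice: each element of [N] is handled from some index on, with tolerance 1/(k+1)
    tending to 0. *)
Lemma folner_sequence : exists K : nat -> {fset G}, forall k,
  [/\ K k != fset0%fset, {in K k, forall x, N x} &
    forall g, N g -> (iota g < k)%N ->
      (k.+1 * #|` (lmulfs g (K k) `\` K k)%fset| < #|` K k|)%N].
Proof.
have [j Hj] := injective_left_inverse iota_inj.
suff HK k : exists K : {fset G}, [/\ K != fset0%fset, {in K, forall x, N x} &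
    forall g, N g -> (iota g < k)%N ->
      (k.+1 * #|` (lmulfs g K `\` K)%fset| < #|` K|)%N].
  by have [K] := choice HK; exists K.
pose F := [fset g in [seq g <- [seq j i | i <- seq.iota 0 k] | `[< N g >]]]%fset.
have FN : {in F, forall g, N g}.
  by move=> g; rewrite !inE mem_filter => /andP[/asboolP].
have [K [K0 KN HK]] := amenable_folner sN k aN FN.
exists K; split => // g Ng gk; apply: HK.
rewrite !inE mem_filter; apply/andP; split; first exact/asboolP.
by apply/mapP; exists (iota g); rewrite ?Hj // mem_iota.
Qed.

Section along_sequence.
Context (K : nat -> {fset G}).
Context (HK : forall k, [/\ K k != fset0%fset, {in K k, forall x, N x} &
    forall g, N g -> (iota g < k)%N ->
      (k.+1 * #|` (lmulfs g (K k) `\` K k)%fset| < #|` K k|)%N]).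

(** The finitely many [h g] are all numbered below some k, from which on each term is less than
    |K|/(k+1). *)
Lemma folner_sum s (h : G -> G) : (forall g, N (h g)) ->
  \forall k \near \oo,
    (k.+1 * \sum_(g <- s) #|` (lmulfs (h g) (K k) `\` K k)%fset| <= size s * #|` K k|)%N.
Proof.
move=> hN; exists (\max_(g <- s) iota (h g)).+1 => // k /= sk.
elim: s sk => [|g s IH]; first by rewrite !big_nil muln0.
rewrite !big_cons gtn_max => /andP[gk sk]; rewrite mulnDr /= mulSn.
by apply: leq_add; [apply: ltnW; have [_ _] := HK k; exact|exact: IH].
Qed.

(** Passing from g to its coset representative multiplies on the right by an element of [N], which
    eventually costs less than |K|/(k+1) points. For representatives the product has exactly |reps
    s| |K| points, and comparing in both directions squeezes the ratio. *)
Lemma folner_ratio_cvg s :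
  ((#|` mulfs [fset g in s]%fset (K k)|%:R / #|` K k|%:R) : R) @[k --> \oo] -->
  ((#|` reps N s|)%:R : R).
Proof.
set l : R := _%:R.
have K0 k : 0 < (#|` K k|)%:R :> R by have [h _ _] := HK k; rewrite ltr0n cardfs_gt0.
apply: (@squeeze_cvgr _ _ _ _ (fun k => l - (size s)%:R * harmonic k)
  (fun k => l + (size s)%:R * harmonic k)).
- have h1 := @folner_sum s (fun g => (coset_rep N g)^-1 * g)%g.
  have h2 := @folner_sum s (fun g => g^-1 * coset_rep N g)%g.
  have N2 g : N (g^-1 * coset_rep N g)%g by exact: coset_repP.
  have N1 g : N ((coset_rep N g)^-1 * g)%g.
    by have := subgroupV sN (N2 g); rewrite invgM invgK.
  near=> k.
  have k1 : (k.+1 * \sum_(g <- s) #|` (lmulfs ((coset_rep N g)^-1 * g)%g (K k) `\` K k)%fset|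
     <= size s * #|` K k|)%N by near: k; exact: h1.
  have k2 : (k.+1 * \sum_(g <- s) #|` (lmulfs (g^-1 * coset_rep N g)%g (K k) `\` K k)%fset|
     <= size s * #|` K k|)%N by near: k; exact: h2.
  have [_ KN _] := HK k.
  have c1 := @card_union_translates G id (coset_rep N) s (K k).
  have c2 := @card_union_translates G (coset_rep N) id s (K k).
  rewrite -mulfs_bigfcup -(mulfs_reps_bigfcup N) (card_mulfs_reps sN) // in c1 c2.
  set A := #|` mulfs _ _| in c1 c2 *; set r := #|` reps N s| in c1 c2 l *.
  have b1 : (k.+1 * A <= k.+1 * (r * #|` K k|) + size s * #|` K k|)%N.
    apply: leq_trans (leq_add (leqnn _) k1).
    by rewrite -mulnDr leq_mul2l c1 orbT.
  have b2 : (k.+1 * (r * #|` K k|) <= k.+1 * A + size s * #|` K k|)%N.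
    apply: leq_trans (leq_add (leqnn _) k2).
    by rewrite -mulnDr leq_mul2l c2 orbT.
  move: b1 b2; rewrite -!(ler_nat R) [in leRHS]natrD ![(k.+1 * _)%:R]natrM !natrM => b1.
  rewrite [in leRHS]natrD ![(k.+1 * _)%:R]natrM !natrM => b2; move: b1 b2.
  have := K0 k; rewrite /l /harmonic /=.
  set a : R := A%:R; set x : R := _%:R; set y : R := (k.+1)%:R; set z : R := (size s)%:R.
  set r' : R := r%:R => x0 b1 b2.
  have y0 : 0 < y by rewrite ltr0n.
  have zy : y * (z / y * x) = z * x.
    by rewrite mulrA [y * (z / y)]mulrC divfK // gt_eqF.
  apply/andP; split.
    rewrite ler_pdivlMr // mulrBl lerBlDr -(ler_pM2l y0). apply: (le_trans b2).
    by rewrite mulrDr zy.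
  rewrite ler_pdivrMr // -(ler_pM2l y0); apply: (le_trans b1).
  by rewrite mulrDl mulrDr zy.
- rewrite -[X in _ --> X]subr0 -(mulr0 (size s)%:R).
  apply: cvgB; first exact: cvg_cst.
  by apply: cvgM; [exact: cvg_cst|exact: cvg_harmonic].
- rewrite -[X in _ --> X]addr0 -(mulr0 (size s)%:R).
  apply: cvgD; first exact: cvg_cst.
  by apply: cvgM; [exact: cvg_cst|exact: cvg_harmonic].
Unshelve. all: by end_near. Qed.

(** With this threshold [factor_law_cyl] gives exp(-|sK|/|K|). *)
Definition folner_law k : probability (cube G) R :=
  factor_law lam (K k) (expR (- (#|` K k|)%:R^-1)).

Lemma folner_law_cvg u C : depends_on u C ->
  pr (folner_law k) C @[k --> \oo] --> pr (quotient_law lam N) C.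
Proof.
apply: depends_on_cvg => s.
rewrite [X in _ --> X](_ : _ = expR (- (#|` reps N s|)%:R)); last first.
  by rewrite /pr (quotient_law_cyl Hlam).
rewrite (_ : (fun k => pr _ _) =
  (fun k => expR (- (#|` mulfs [fset g in s]%fset (K k)|%:R / #|` K k|%:R)))).
  apply: continuous_cvg; first exact: continuous_expR.
  by apply: cvgN; exact: folner_ratio_cvg.
apply/funext => k; rewrite /pr factor_law_cyl //.
  by rewrite /= -expRM_natl mulrN.
by rewrite expR_ge0 /= -[leRHS]expR0 ler_expR oppr_le0 invr_ge0.
Qed.

End along_sequence.

Lemma near_seq (T : eqType) (s : seq T) (Q : T -> nat -> Prop) :
  (forall x, x \in s -> \forall k \near \oo, Q x k) ->
  \forall k \near \oo, forall x, x \in s -> Q x k.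
Proof.
elim: s => [|x s IH] H; first by apply: nearW.
have h1 : \forall k \near \oo, Q x k by apply: H; rewrite inE eqxx.
have h2 : \forall k \near \oo, forall y, y \in s -> Q y k.
  by apply: IH => y ys; apply: H; rewrite inE ys orbT.
apply: filterS2 h1 h2 => k h1 h2 y.
by rewrite inE => /predU1P[->//|/h2].
Qed.

(** The test sets are replaced by sets depending on finitely many coordinates, for which the law of
    some finite factor is close to the limit law. Their preimages under that equivariant factor
    serve as [B]. *)
Lemma quotient_weakly_contained :
  weakly_contained (quotient_law lam N) (@cube_shift G) lam (@Defs.shift R G).
Proof.
move=> n A F e mA finF e0.
have [s ->] : exists s : seq G, F = [set` s] by exact/finite_seqP.
have [K HK] := folner_sequence.
set P := quotient_law lam N.
(* Two thirds of [e] pay for approximating [A i] and [A j], the last third for the change of law. *)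
have d0 : 0 < e / 3 by rewrite divr_gt0.
have approx i : exists uC : seq G * set (cube G),
    depends_on uC.1 uC.2 /\ pr P (symdiff (A i) uC.2) < e / 3.
  by have [u [C uC]] := depends_on_approx P (mA i) d0; exists (u, C).
have [uC HuC] := choice approx.
pose C i := (uC i).2.
have uCdep i : depends_on (uC i).1 (C i) by exact: (HuC i).1.
have mC i : measurable (C i) := depends_on_measurable (uCdep i).
have mS (g : G) B : measurable B -> measurable (cube_shift g @^-1` B).
  by apply: measurable_preimage; exact: measurable_cube_shift.
pose X g i j := cube_shift g^-1%g @^-1` C i `&` C j.
have Xdep g i j : depends_on ([seq (g * h)%g | h <- (uC i).1] ++ (uC j).1) (X g i j).
  apply: depends_onI => // x y xy; apply: uCdep => h hu.
  by rewrite /cube_shift invgK; apply: xy; exact: map_f.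
have [k [_ Hk]] : exists k, True /\ forall g, g \in s -> forall i j,
    `|pr P (X g i j) - pr (folner_law K k) (X g i j)| < e / 3.
  have : \forall k \near \oo, forall g, g \in s -> forall i j,
      `|pr P (X g i j) - pr (folner_law K k) (X g i j)| < e / 3.
    apply: near_seq => g _; apply: filter_forall => i; apply: filter_forall => j.
    exact: (cvgrPdist_lt _ _).1 (folner_law_cvg HK (Xdep g i j)) _ d0.
  by move=> /filter_ex[k Hk]; exists k.
pose c : R := expR (- (#|` K k|)%:R^-1).
pose B i : set (shift_space R G) := finite_factor (K k) c @^-1` C i.
have mB i : measurable (B i).
  by apply: measurable_preimage => //; exact: measurable_finite_factor.
exists B; split => // g i j gs.
(* By equivariance the translate of [B i] is the preimage of the translate of [C i]. *)
have -> : (Defs.shift g @` B i `&` B j) = finite_factor (K k) c @^-1` X g i j.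
  rewrite image_shift; apply/seteqP; split => f /= [].
    by rewrite /B /= finite_factor_shift => ? ?; split.
  by rewrite /X /= => ? ?; split => //; rewrite /B /= finite_factor_shift.
rewrite image_cube_shift.
have mX : measurable (X g i j) := depends_on_measurable (Xdep g i j).
have mA' : measurable (cube_shift g^-1%g @^-1` A i `&` A j).
  by apply: measurableI => //; exact: mS.
rewrite -[lam _]/(folner_law K k (X g i j)) (prE P) // (prE (folner_law K k)) //.
rewrite -EFinB /= lte_fin.
have h1 : `|pr P (cube_shift g^-1%g @^-1` A i `&` A j) - pr P (X g i j)| <=
    pr P (symdiff (A i) (C i)) + pr P (symdiff (A j) (C j)).
  apply: (le_trans (pr_symdiff P mA' mX)).
  (* Invariance of the law makes the error for the translate of [A i] equal to the error for [A i]
     itself. *)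
  have inv : pr P (symdiff (A i) (C i)) = pr P (cube_shift g^-1%g @^-1` symdiff (A i) (C i)).
    by rewrite /pr quotient_law_invariant //; exact: measurable_symdiff.
  rewrite inv; apply: le_trans (pr_setU_le _ _ _).
  - apply: le_pr; [exact: measurable_symdiff| |exact: symdiff_setI].
    by apply: measurableU; [apply: mS|]; exact: measurable_symdiff.
  - by apply: mS; exact: measurable_symdiff.
  - exact: measurable_symdiff.
have h2 := Hk g gs i j; have h3 := (HuC i).2; have h4 := (HuC j).2.
have h5 := ler_distD (pr P (X g i j)) (pr P (cube_shift g^-1%g @^-1` A i `&` A j))
  (pr (folner_law K k) (X g i j)).
rewrite -/(C i) in h3; rewrite -/(C j) in h4.
lra.
Qed.

End weak_limit.

Theorem proposition3p15 (R : realType) (G : groupType)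
    (G_countable : countable [set: G]) :
  shift_minimal R G ->
  ~ (exists N : set G,
      [/\ normal_subgroup N, amenable R N & N <> [set 1%g]]).
Proof.
move=> minimal [N [[sN nN] aN N1]].
have /countable_injP[iota iotaP] := G_countable.
have iota_inj : injective iota by move=> x y; apply: iotaP; rewrite inE.
have [lam Hlam] := exists_product_lebesgue R iota_inj.
have [g [Ng g1]] : exists g, N g /\ g <> 1%g.
  apply: contrapT => H; apply: N1; apply/seteqP; split => g /=.
    by move=> Ng; apply: contrapT => g1; apply: H; exists g.
  by move=> ->; exact: subgroup1.
apply: (quotient_not_free (lam := lam) sN nN Ng g1).
apply: (minimal lam Hlam).
- exact: quotient_mp_action iota_inj.
- exact: quotient_not_point_mass.
- exact: quotient_weakly_contained iota_inj _ _.
Qed.
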